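(* Let $b\ge 2$ be an integer. For every activity $\lambda$ with $0<\lambda\le \dfrac{b^b}{(b-1)^{b+1}}$, the $C=2$ multi-state hard core model on the infinite rooted $b$-ary tree $\mathbb{T}^b$ with activity $\lambda$ has a unique Gibbs measure.
   Context: $\mathbb{T}^b$ is the infinite rooted $b$-ary tree: the infinite graph without cycles in which the root $r$ has exactly $b$ neighbors and every other vertex has exactly $b+1$ neighbors. For a graph $G=(V,E)$ and an integer $C\ge 1$, put $S_C=\{0,1,\dots,C\}$ and let $\Omega_G=\{\sigma\in S_C^V:\ \sigma_x+\sigma_y\le C \text{ for every } xy\in E\}$ be the set of allowable configurations. For a finite graph $G$ and activity $\lambda>0$, $\mu_{G,\lambda}$ is the probability measure on $\Omega_G$ with $\mu_{G,\lambda}(\sigma)\propto\prod_{v\in V}\lambda^{\sigma_v}$. For $U\subset V$, $\partial U=\{x\in V\setminus U: xz\in E\text{ for some }z\in U\}$, $\overline U=U\cup\partial U$, $G[\overline U]$ is the restriction (induced subgraph) of $G$ to $\overline U$, and $\sigma_U$ is the restriction of $\sigma$ to $U$. A Gibbs measure on $G$ with capacity $C$ and activity $\lambda$ is a probability measure $\mu$ on $S_C^V$ (with the product $\sigma$-field), concentrated on $\Omega_G$, such that for every finite $U\subset V$ and $\mu$-almost every $\tau$, $\mu(\sigma_U=\tau_U\mid\sigma_{V\setminus U}=\tau_{V\setminus U})=\mu_{G[\overline U],\lambda}(\sigma_U=\tau_U\mid\sigma_{\partial U}=\tau_{\partial U})$. *)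

(* Defs.v *)
From HB Require Import structures.
From mathcomp Require Import all_boot all_order all_algebra.
From mathcomp Require Import finmap.
From mathcomp Require Import all_classical all_reals all_analysis.

Set Implicit Arguments.
Unset Strict Implicit.
Unset Printing Implicit Defensive.

Import Order.TTheory GRing.Theory Num.Theory.
Import numFieldNormedType.Exports.

Local Open Scope classical_set_scope.
Local Open Scope ring_scope.

(* A graph is given by its vertex type and its adjacency relation; spins are
   in S_C = 'I_C.+1. *)
Definition allowable (V : Type) (C : nat) (adj : rel V) (s : V -> 'I_C.+1) :
    Prop :=
  forall x y, adj x y -> (s x + s y <= C)%N.

Section FiniteGraph.
Variables (R : realType) (V : finType) (C : nat) (adj : rel V) (lam : R).
Implicit Types A B : pred {ffun V -> 'I_C.+1}.

Definition hc_weight (s : {ffun V -> 'I_C.+1}) : R :=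
  \prod_(v : V) lam ^+ (s v : nat).

Definition hc_partition : R :=
  \sum_(s : {ffun V -> 'I_C.+1} | `[< allowable adj s >]) hc_weight s.

Definition hc_measure A : R :=
  (\sum_(s : {ffun V -> 'I_C.+1} | `[< allowable adj s >] && A s) hc_weight s)
  / hc_partition.

Definition hc_cond A B : R := hc_measure (predI A B) / hc_measure B.

End FiniteGraph.

Section ConditionalProbability.
Context d (T : measurableType d) (R : realType).

(* [f] is a version of the conditional probability of [A] given the
   sub-sigma-algebra [F]. *)
Definition is_cond_prob (mu : probability T R) (F : set (set T)) (A : set T)
    (f : T -> R) : Prop :=
  [/\ forall B : set R, measurable B -> F (f @^-1` B),
      mu.-integrable setT (EFin \o f) &
      forall B, F B -> (\int[mu]_(t in B) (f t)%:E = mu (A `&` B))%E].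

End ConditionalProbability.

Section GibbsMeasure.
Variables (V : choiceType) (C : nat).

Definition spins := V -> 'I_C.+1.

HB.instance Definition _ := Choice.on spins.
HB.instance Definition _ := isPointed.Build spins (fun=> ord0).

Definition cylinders (W : set V) : set (set spins) :=
  [set [set s : spins | s v = a] | v in W & a in [set: 'I_C.+1]].

Definition coord_salgebra (W : set V) : set (set spins) := <<s cylinders W >>.

(* S_C^V with the product sigma-algebra. *)
Definition config := g_sigma_algebraType (cylinders setT).

Definition restr (U : {fset V}) (s : config) : {ffun U -> 'I_C.+1} :=
  [ffun x : U => s (val x)].

Definition agree (W A : {fset V}) (s : {ffun W -> 'I_C.+1}) (t : config) :
    bool :=
  [forall x : W, (val x \in A) ==> (s x == t (val x))].

Variable adj : rel V.

(* [fset_set] returns the empty set on infinite sets, so the definitions below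
   are meaningful for locally finite graphs only. *)
Definition bdry (U : {fset V}) : {fset V} :=
  fset_set [set x | x \notin U /\ exists2 z, z \in U & adj x z].

Definition closed_nbhd (U : {fset V}) : {fset V} := (U `|` bdry U)%fset.

Definition induced (W : {fset V}) : rel W := fun x y => adj (val x) (val y).

Variables (R : realType) (lam : R).

(* mu_{G[closure of U]}(s_U = t_U | s_{bdry U} = t_{bdry U}) *)
Definition local_spec (U : {fset V}) (t : config) : R :=
  @hc_cond R (closed_nbhd U) C (@induced (closed_nbhd U)) lam
    (fun s => agree U s t) (fun s => agree (bdry U) s t).

(* The conditional probability of the random event {s_U = t_U} at t is obtained
   by taking, for each of the finitely many values eta of t_U, a version
   [f eta] of the conditional probability of {s_U = eta}, and evaluating
   [f (t_U)] at t. *)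
Definition is_gibbs (mu : probability config R) : Prop :=
  {ae mu, forall t, allowable adj t} /\
  forall U : {fset V},
    exists f : {ffun U -> 'I_C.+1} -> config -> R,
      (forall eta, is_cond_prob mu (coord_salgebra (~` [set` U]))
                     [set s | restr U s = eta] (f eta)) /\
      {ae mu, forall t, f (restr U t) t = local_spec U t}.

(* Two measures are identified when they agree on measurable sets: outside of
   the sigma-algebra their values are irrelevant. *)
Definition has_unique_gibbs : Prop :=
  exists mu : probability config R, is_gibbs mu /\
    forall nu : probability config R, is_gibbs nu ->
      forall A : set config, measurable A -> nu A = mu A.

End GibbsMeasure.

(* The infinite rooted b-ary tree: vertices are words over 'I_b, the root is
   [::] and the children of x are the words i :: x. *)
Definition tree_adj (b : nat) : rel (seq 'I_b) :=
  fun x y => [exists i, y == i :: x] || [exists i, x == i :: y].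

Lemma in_bdry_tree (b : nat) (U : {fset seq 'I_b}) (x : seq 'I_b) :
  x \in bdry (@tree_adj b) U <->
  x \notin U /\ exists2 z, z \in U & tree_adj x z.
Proof.
rewrite /bdry in_fset_set; first by rewrite inE.
pose N := [seq behead z | z <- U] ++ [seq i :: z | z <- U, i <- enum 'I_b].
apply: (@sub_finite_set _ _ [set` N]); last exact: finite_seq.
move=> y /= [_ [z zU /orP[]/existsP[i /eqP e]]]; rewrite mem_cat; apply/orP.
  by left; apply/mapP; exists z => //; rewrite e.
right; apply/allpairsP; exists (z, i).
by split => //=; rewrite mem_enum.
Qed.

(* Main.v *)
From HB Require Import structures.
Require Import Defs.
From mathcomp Require Import all_boot all_order all_algebra.
From mathcomp Require Import finmap.
From mathcomp Require Import all_classical all_reals all_analysis.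
From mathcomp Require Import measurable_realfun ring lra zify.
Import Order.TTheory GRing.Theory Num.Theory.
Import numFieldNormedType.Exports.
Local Open Scope ring_scope.

Set Implicit Arguments.
Unset Strict Implicit.
Unset Printing Implicit Defensive.

(** Throughout, the branching number is b = n.+1.

Cut the tree above a vertex.  The part below acts on the rest only through
the three numbers S 0 >= S 1 >= S 2, where S j is the total weight of the
configurations below the cut that tolerate spin j just above it.  Up to a
scalar they amount to beta = S 1 / S 0 and gamma = S 2 / S 1.  If all the
children of a vertex send the pair (beta, gamma), the vertex itself sends
[msg_map] (beta, gamma), that is
    (1 / (1 + lam * gamma^b * (1 - h beta)), h beta)
with h x = 1 / (1 + lam * x^b).  This map is antitone, and unequal messages
from the children are handled by monotonicity ([in_bounds_rec]).  So, whatever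
is prescribed far away, the message is trapped between two explicit sequences
started at (0, 0) and (1, 1) ([msg_bounds]); their limits (y, c) and (x, a),
with y <= x and c <= a, are exchanged by the map.  Everything rests on the fact
that such a 2-cycle is a fixed point ([two_cycle_trivial]).

The second coordinate of the map is the recursion h of the usual hard core
model, for which b^b / (b-1)^(b+1) is the uniqueness threshold.  The cycle
satisfies 1/y - 1 = lam * a^b * (1 - c), which is less than lam * a^b, and
up to the threshold this forces y > (b-1)/b ([hardcore_threshold]).  The bound
on lam also keeps 1 - c at most 4/(b+3), and this extra factor is the room that
makes the argument close: fed back into the equation for y, it yields
b * (1-y) * (1 + (b-1) * (1-c)) < 1 ([quadratic_gap]), which says exactly that
the map contracts the logarithms of x/y and a/c.

On the probabilistic side the vertices are numbered as in a heap, the children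
of v being b*v+1, ..., b*v+b, so that any initial segment of the numbering is a
subtree, and a probability on configurations is determined by the masses of the
cylinders over initial segments ([probability_prefix_ext]).  At the fixed
point, the weight of such a cylinder with each cut edge weighted by the
corresponding message is a consistent family of masses, hence comes from a
measure ([kolmogorov_extension]), and that measure is Gibbs
([cut_measure_gibbs]).  Conversely, the masses given by any Gibbs measure obey
the ratio form of the Gibbs property on initial segments ([gibbs_cut]).
Summing out the vertices from the last one backwards turns the far boundary
into messages ([sumc_msg]); these are trapped, so the masses must be
proportional to those of the fixed point ([marginal_ratio]). *)

(** * Inequalities for the hard core recursion *)
Lemma bernoulli_ineq (R : realType) (x : R) (k : nat) :
  -1 <= x -> 1 + k%:R * x <= (1 + x) ^+ k.
Proof.
move=> x1; elim: k => [|k IH]; first by rewrite mul0r addr0 expr0.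
rewrite exprS -natr1.
have : (1 + x) * (1 + k%:R * x) <= (1 + x) * (1 + x) ^+ k.
  by apply: ler_wpM2l => //; lra.
have : 0 <= k%:R * x ^+ 2 by rewrite mulr_ge0 ?ler0n ?sqr_ge0.
by rewrite expr2; lra.
Qed.

(** The sequence (1 + 1/n)^(n+1) decreases from the value 4 at n = 1. *)
Lemma expSn_le4 (R : realType) (n : nat) : (0 < n)%N ->
  n.+1%:R ^+ n.+1 <= 4 * n%:R ^+ n.+1 :> R.
Proof.
elim: n => // -[_ _|n IH _]; first by rewrite expr1n; lra.
have {IH} := IH isT; set N : R := n.+1%:R => IH.
have N1 : 1 <= N by rewrite ler1n.
rewrite -[n.+3%:R]natr1 -[n.+2%:R]natr1 -/N.
rewrite -[n.+2%:R]natr1 -/N in IH.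
have Np : 0 < N ^+ n.+2 by rewrite exprn_gt0 //; lra.
have Mp : 0 < (N + 1) ^+ n.+2 by rewrite exprn_gt0 //; lra.
(* consecutive terms are compared through ((N+1)^2 / (N (N+2)))^(n+2), to
   which Bernoulli applies *)
have key : (N * (N + 1 + 1)) ^+ n.+2 * (N + 1 + 1) <= ((N + 1) ^+ 2) ^+ n.+2 * (N + 1).
  have q0 : 0 < N * (N + 1 + 1) by rewrite mulr_gt0; lra.
  have := @bernoulli_ineq R (1 / (N * (N + 1 + 1))) n.+2.
  have -> : 1 + 1 / (N * (N + 1 + 1)) = (N + 1) ^+ 2 / (N * (N + 1 + 1)).
    by field; apply/andP; split; lra.
  rewrite expr_div_n -[n.+2%:R]natr1 -/N => B.
  have {B} : 1 + (N + 1) * (1 / (N * (N + 1 + 1))) <=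
     ((N + 1) ^+ 2) ^+ n.+2 / (N * (N + 1 + 1)) ^+ n.+2.
    apply: B; apply: (@le_trans _ _ 0); first lra.
    by rewrite divr_ge0 // ltW.
  rewrite ler_pdivlMr ?exprn_gt0 // => B.
  have : (N + 1 + 1) / (N + 1) <= 1 + (N + 1) * (1 / (N * (N + 1 + 1))).
    rewrite -subr_ge0.
    have -> : 1 + (N + 1) * (1 / (N * (N + 1 + 1))) - (N + 1 + 1) / (N + 1) =
      1 / (N * (N + 1 + 1) * (N + 1)).
      by field; rewrite !andb_true_intro //; repeat split; lra.
    by rewrite divr_ge0 // mulr_ge0 //; nra.
  move=> C.
  have : (N + 1 + 1) / (N + 1) * (N * (N + 1 + 1)) ^+ n.+2 <= ((N + 1) ^+ 2) ^+ n.+2.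
    by apply: le_trans B; rewrite ler_wpM2r // exprn_ge0 // ltW.
  by rewrite mulrAC ler_pdivrMr; [rewrite mulrC|lra].
rewrite exprMn_comm in key; last exact: mulrC.
rewrite exprAC in key.
have P0 : 0 < (N+1+1) ^+ n.+2 by rewrite exprn_gt0 //; lra.
set X := (N+1+1) ^+ n.+2 in P0 key *; set Y := (N+1) ^+ n.+2 in Mp key IH *; set Z := N ^+ n.+2 in Np key IH.
rewrite exprSr -/X [X in _ <= 4 * X]exprSr -/Y.
have XY : Z * X * (N+1+1) <= 4 * Z * Y * (N + 1).
  apply: (le_trans key); rewrite expr2 -[leLHS]mulrA -[leRHS]mulrA.
  by rewrite ler_pM2r // mulr_gt0 //; lra.
by rewrite -(ler_pM2l Np); lra.
Qed.

(** With w = lam * y^b, the numbers b * (1 - y) and b * w / (1 + w) are, up to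
    sign, the logarithmic slopes of the hard core recursion at the two points
    of a cycle through y, so this says that no cycle is expanding.  The worst y
    is (b-1)/b, so Bernoulli is applied to the ratio of (b-1)/b to y. *)
Lemma hardcore_deriv_bound (R : realType) (n : nat) (lam y : R) :
  (0 < n)%N -> 0 < lam -> 0 < y <= 1 ->
  lam * (n%:R / n.+1%:R) ^+ n.+1 * n%:R <= 1 ->
  (1 - y) * n.+1%:R ^+ 2 * (lam * y ^+ n.+1) <= 1 + lam * y ^+ n.+1.
Proof.
move=> n0 l0 /andP[y0 y1] hl.
have N1 : 1 <= n%:R :> R by rewrite ler1n.
set N : R := n%:R in N1 hl *; rewrite -[n.+1%:R]natr1 -/N in hl *.
set m := N / (N + 1) in hl *.
have m0 : 0 < m by rewrite divr_gt0; lra.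
have B : (N + 1) ^+ 2 * (1 - y) - 1 <= N * (m / y) ^+ n.+1.
  have /bernoulli_ineq H : -1 <= m / y - 1.
    by rewrite lerBrDr addNr divr_ge0 // ltW.
  have {H} := H n.+1; rewrite [1 + (m / y - 1)]addrCA subrr addr0 -[n.+1%:R]natr1 -/N => H.
  have : N * (1 + (N + 1) * (m / y - 1)) <= N * (m / y) ^+ n.+1.
    by rewrite ler_wpM2l //; lra.
  apply: le_trans; rewrite -subr_ge0 [leRHS](_ : _ = (N - (N + 1) * y) ^+ 2 / y).
    by rewrite divr_ge0 ?sqr_ge0 // ltW.
  by rewrite /m; field; rewrite !gt_eqF //; lra.
have yp : 0 < lam * y ^+ n.+1 by rewrite mulr_gt0 // exprn_gt0.
have : lam * y ^+ n.+1 * ((N + 1) ^+ 2 * (1 - y) - 1) <= 1.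
  apply: le_trans hl; apply: (@le_trans _ _ (lam * y ^+ n.+1 * (N * (m / y) ^+ n.+1))).
    by rewrite ler_pM2l.
  rewrite expr_div_n le_eqVlt; apply/orP; left; apply/eqP.
  by field; rewrite gt_eqF // exprn_gt0.
by lra.
Qed.

(** The right-hand side is decreasing in y, by [hardcore_deriv_bound], and at
    y = (b-1)/b it is at least lam by Bernoulli, with equality at the critical
    activity. *)
Lemma hardcore_threshold (R : realType) (n : nat) (lam y : R) :
  (0 < n)%N -> 0 < lam ->
  lam * (n%:R / n.+1%:R) ^+ n.+1 * n%:R <= 1 ->
  0 < y <= n%:R / n.+1%:R ->
  lam <= (y^-1 - 1) * (1 + lam * y ^+ n.+1) ^+ n.+1.
Proof.
move=> n0 l0 hl /andP[y0 ym].
have N1 : 1 <= n%:R :> R by rewrite ler1n.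
set N : R := n%:R in N1 hl ym *; have NS : n.+1%:R = N + 1 by rewrite natr1.
rewrite NS in hl ym *.
set m := N / (N + 1) in hl ym *.
have m1 : m < 1 by rewrite ltr_pdivrMr; lra.
have m0 : 0 < m by rewrite divr_gt0; lra.
pose G (u : R) := (u^-1 - 1) * (1 + lam * u ^+ n.+1) ^+ n.+1.
pose dG (u : R) := - u ^- 2 * (1 + lam * u ^+ n.+1) ^+ n.+1 +
  (u^-1 - 1) * (n.+1%:R * (1 + lam * u ^+ n.+1) ^+ n * (lam * (n.+1%:R * u ^+ n))).
have dGP (u : R) : 0 < u -> is_derive u 1 G (dG u).
  move=> u0.
  have un0 : u != 0 by rewrite gt_eqF.
  rewrite /G /dG.
  have D1 : is_derive u (1 : R) (fun u : R => u^-1 - 1) (- u ^- 2).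
    have -> : (fun u : R => u^-1 - 1) = ((fun u : R => u^-1) - cst 1) by [].
    apply: is_derive_eq; first by apply: is_deriveB; apply: is_deriveV.
    by rewrite /= subr0 scaler1.
  have D2 : is_derive u (1 : R) (fun u : R => 1 + lam * u ^+ n.+1) (lam * (n.+1%:R * u ^+ n)).
    have -> : (fun u : R => 1 + lam * u ^+ n.+1) = (cst 1 + (lam \*: (@id R ^+ n.+1))).
      by apply/funext => z /=; rewrite !fctE.
    apply: is_derive_eq.
    by rewrite add0r /= [X in _ *: X]scaler1.
  have -> : (fun u => (u^-1 - 1) * (1 + lam * u ^+ n.+1) ^+ n.+1) =
    (fun u : R => u^-1 - 1) * ((fun u : R => 1 + lam * u ^+ n.+1) ^+ n.+1).
    by apply/funext => z /=; rewrite !fctE.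
  apply: is_derive_eq.
  rewrite /= !fctE /GRing.scale /=; ring.
have Gm : lam <= G m.
  rewrite /G; set w := lam * m ^+ n.+1.
  have w0 : 0 < w by rewrite mulr_gt0 // exprn_gt0.
  have /bernoulli_ineq : -1 <= m * (1 + w) - 1.
    by rewrite lerBrDr addNr mulr_ge0 //; lra.
  move=> /(_ n.+1); rewrite NS [1 + (m * _ - 1)]addrCA subrr addr0 exprMn.
  have -> : 1 + (N + 1) * (m * (1 + w) - 1) = N * w.
    by rewrite /m; field; rewrite gt_eqF //; lra.
  have -> : m^-1 - 1 = N^-1 by rewrite /m; field; rewrite !gt_eqF //; lra.
  move=> H; rewrite mulrC ler_pdivlMr; last lra.
  have : m ^+ n.+1 * (lam * N) <= m ^+ n.+1 * (1 + w) ^+ n.+1.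
    by apply: le_trans H; rewrite /w le_eqVlt; apply/orP; left; apply/eqP; ring.
  by rewrite ler_pM2l // exprn_gt0.
apply: (le_trans Gm).
have [->//|/eqP ynm] := eqVneq y m.
have {ynm}ym' : y < m by rewrite lt_neqAle ym andbT; apply/eqP.
have [| |c cym GE] := @MVT R G dG y m ym'.
- by move=> x; rewrite in_itv /= => /andP[xy _]; apply: dGP; apply: lt_trans xy.
- apply: derivable_within_continuous => x; rewrite in_itv /= => /andP[xy _].
  by have [] := dGP x (lt_le_trans y0 xy).
move: cym; rewrite in_itv /= => /andP[yc cm].
rewrite -subr_le0 -/(G y) GE pmulr_lle0 ?subr_gt0 //.
have c0 : 0 < c by apply: lt_trans yc.
have cc : 0 < c <= 1 by rewrite c0 ltW //; apply: lt_trans m1.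
have := hardcore_deriv_bound n0 l0 cc; rewrite NS -/N -/m => /(_ hl) Db.
have cn : 0 < c ^+ n by rewrite exprn_gt0.
rewrite /dG NS; set w := lam * c ^+ n.+1 in Db *.
have w0 : 0 < w by rewrite mulr_gt0 // exprn_gt0.
have -> : - c ^- 2 * (1 + w) ^+ n.+1 + (c^-1 - 1) * ((N + 1) * (1 + w) ^+ n * (lam * ((N + 1) * c ^+ n)))
  = (1 + w) ^+ n / c ^+ 2 * ((1 - c) * (N + 1) ^+ 2 * w - (1 + w)).
  by rewrite (exprSr (1 + w) n) /w (exprSr c n); field; rewrite gt_eqF.
rewrite mulr_ge0_le0 ?subr_le0 // divr_ge0 ?exprn_ge0 //; [by lra|exact: ltW].
Qed.

(** Concavity of ln, used at 1 and W / Z with weight Z / (1 + Z) on the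
    latter.  In terms of z = ln Z, this is the tangent at z to the convex
    function ln (1 + e^z). *)
Lemma ln1D_contraction (R : realType) (Z W : R) : 0 < W -> 0 < Z ->
  ln (1 + Z) - ln (1 + W) <= Z / (1 + Z) * (ln Z - ln W).
Proof.
move=> W0 Z0; set s := Z / (1 + Z).
have Z1 : 0 < 1 + Z by lra.
have s0 : 0 <= s by rewrite divr_ge0 //; lra.
have s1 : s <= 1 by rewrite ler_pdivrMr //; lra.
have WZ : 0 < W / Z by rewrite divr_gt0.
have := @concave_ln R (Itv01 s0 s1) (W / Z) 1 WZ ltr01.
rewrite !convRE /= ln1 mulr0 addr0 mulr1.
have -> : s * (W / Z) + (1 - s) = (1 + W) / (1 + Z).
  by rewrite /s; field; rewrite !gt_eqF.
rewrite !ln_div ?posrE //; [|lra].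
by rewrite mulrBr mulrBr; lra.
Qed.

Lemma ln_mulXn (R : realType) (l x : R) (k : nat) : 0 < l -> 0 < x ->
  ln (l * x ^+ k) = ln l + k%:R * ln x.
Proof. by move=> l0 x0; rewrite lnM ?posrE ?exprn_gt0 // lnXn // mulr_natl. Qed.

(** With T = 4/(n+4), the claim at the extreme values reduces to the positivity
    of n * (3 n - 4)^2, whose only positive zero, 4/3, is not an integer. *)
Lemma quadratic_gap (R : realType) (n : nat) (z t : R) : (0 < n)%N ->
  0 <= z <= 1 -> t * (n%:R + 4) <= 4 -> (2 - z) * z <= t -> z * (1 + n%:R * t) < 1.
Proof.
move=> n0 /andP[z0 z1] ht hz.
have N1 : 1 <= n%:R :> R by rewrite ler1n.
have sq : 0 < (3 * n%:R - 4 : R) ^+ 2.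
  rewrite exprn_even_gt0 //=.
  rewrite -natrM subr_eq0 eqr_nat; lia.
set N : R := n%:R in N1 ht sq *.
rewrite ltNge; apply/negP => hz1.
have tT : t <= 4 / (N + 4) by rewrite ler_pdivlMr //; lra.
(* otherwise z is at least (N+4)/(5N+4), where (2-z)z already exceeds T *)
have zz : N + 4 <= z * (5 * N + 4).
  have : z * (1 + N * t) * (N + 4) <= z * (5 * N + 4).
    by rewrite -mulrA ler_wpM2l //; nra.
  by nra.
have h1 : (2 - z) * z * (N + 4) <= 4.
  apply: le_trans ht; rewrite ler_wpM2r //; lra.
have h2 : (9 * N + 4) * (N + 4) <= (2 - z) * z * (5 * N + 4) ^+ 2.
  set u := z * (5 * N + 4) in zz.
  rewrite [leRHS](_ : _ = (10 * N + 8 - u) * u); last by rewrite /u; ring.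
  have uu : u <= 5 * N + 4 by rewrite /u; nra.
  by nra.
have h3 : (9 * N + 4) * (N + 4) * (N + 4) <= 4 * (5 * N + 4) ^+ 2.
  apply: (@le_trans _ _ ((2 - z) * z * (5 * N + 4) ^+ 2 * (N + 4))).
    by rewrite ler_wpM2r //; lra.
  by rewrite mulrAC ler_wpM2r // sqr_ge0.
have : N * (3 * N - 4) ^+ 2 <= 0 by move: h3; clear; nra.
by apply/negP; rewrite -ltNge mulr_gt0 //; lra.
Qed.

(** * Two-cycles of the message map are fixed points *)
Section TwoCycle.
Variables (R : realType) (n : nat) (lam : R).
Hypotheses (n0 : (0 < n)%N) (l0 : 0 < lam).
Hypothesis hl : lam * (n%:R / n.+1%:R) ^+ n.+1 * n%:R <= 1.

Let N : R := n%:R.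
Let m : R := N / (N + 1).

Let NS : n.+1%:R = N + 1. Proof. by rewrite natr1. Qed.
Let m0 : 0 < m.
Proof.
have N1 : 1 <= N by rewrite ler1n.
by rewrite divr_gt0 //; lra. Qed.

(** The threshold is (1/n) * (1 + 1/n)^(n+1), and [expSn_le4] bounds the power. *)
Lemma activity_bound : lam * N <= 4.
Proof.
have N1 : 1 <= N by rewrite ler1n.
have q0 : 0 < m ^+ n.+1 by rewrite exprn_gt0.
have : 1 <= 4 * m ^+ n.+1.
  rewrite expr_div_n mulrA ler_pdivlMr ?exprn_gt0 ?mul1r //; last lra.
  by rewrite -NS; apply: expSn_le4.
have : lam * N * m ^+ n.+1 <= 1 by rewrite mulrAC /m -NS.
have : 0 < lam * N by rewrite mulr_gt0 //; lra.
by nra.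
Qed.

(** The maximum of a^(b-1) * (1-a) is attained at (b-1)/b. *)
Lemma hardcore_max (a : R) : 0 < a -> a ^+ n * (1 - a) * (N + 1) <= m ^+ n.
Proof.
have N1 : 1 <= N by rewrite ler1n.
move=> a0.
have /bernoulli_ineq : -1 <= m / a - 1.
  by rewrite lerBrDr addNr divr_ge0 // ltW.
move=> /(_ n); rewrite [1 + (m / a - 1)]addrCA subrr addr0 expr_div_n -/N.
have an0 : 0 < a ^+ n by rewrite exprn_gt0.
rewrite ler_pdivlMr // => H; apply: le_trans H.
rewrite [leLHS](_ : _ = (1 - a) * (N + 1) * a ^+ n); last by ring.
rewrite ler_pM2r // -subr_ge0.
rewrite [leRHS](_ : _ = (N - (N + 1) * a) ^+ 2 / ((N + 1) * a)).
  by rewrite divr_ge0 ?sqr_ge0 // mulr_ge0 ?ltW //; lra.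
by rewrite /m; field; rewrite !gt_eqF //; lra.
Qed.

Variables (x y a c : R).
Hypotheses (y0 : 0 < y) (yx : y <= x) (x1 : x <= 1).
Hypotheses (hc : c = (1 + lam * x ^+ n.+1)^-1) (ha : a = (1 + lam * y ^+ n.+1)^-1).
Hypotheses (hy : y = (1 + lam * a ^+ n.+1 * (1 - c))^-1)
           (hx : x = (1 + lam * c ^+ n.+1 * (1 - a))^-1).

(** First y > (b-1)/b by the hard core threshold.  The cycle equations imply
    y^(b-1) * (1-y) = t * a^(b-1) * (1-a) with t = 1 - c, and the right side is
    at most t times the maximum of that function; since y lies on its
    decreasing branch, y is close to 1, in the quantitative form [gap].
    Finally, with q = ln (x/y) and r = ln (a/c), the two recursions give
    r <= t * b * q and q <= (1-y) * ((b-1) * r + b * q), and [gap] makes this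
    impossible unless q = 0. *)
Lemma two_cycle_trivial : x = y.
Proof.
have N1 : 1 <= N by rewrite ler1n.
have x0 : 0 < x by apply: lt_le_trans yx.
have xp : 0 < x ^+ n.+1 by rewrite exprn_gt0.
have yp : 0 < y ^+ n.+1 by rewrite exprn_gt0.
have X0 : 0 < lam * x ^+ n.+1 by rewrite mulr_gt0.
have Y0 : 0 < lam * y ^+ n.+1 by rewrite mulr_gt0.
have c0 : 0 < c by rewrite hc invr_gt0; lra.
have a0 : 0 < a by rewrite ha invr_gt0; lra.
have c1 : c < 1 by rewrite hc invf_lt1; lra.
have a1 : a < 1 by rewrite ha invf_lt1; lra.
have cE : 1 - c = lam * x ^+ n.+1 * c by rewrite hc; field; rewrite gt_eqF //; lra.
have aE : 1 - a = lam * y ^+ n.+1 * a by rewrite ha; field; rewrite gt_eqF //; lra.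
have ap : 0 < a ^+ n.+1 by rewrite exprn_gt0.
have cp : 0 < c ^+ n.+1 by rewrite exprn_gt0.
pose Z := lam * a ^+ n.+1 * (1 - c); pose W := lam * c ^+ n.+1 * (1 - a).
have Z0 : 0 < Z by rewrite !mulr_gt0 // subr_gt0.
have W0 : 0 < W by rewrite !mulr_gt0 // subr_gt0.
have yE : 1 - y = Z * y by rewrite hy -/Z; field; rewrite gt_eqF //; lra.
have xE : 1 - x = W * x by rewrite hx -/W; field; rewrite gt_eqF //; lra.
have yV : y^-1 - 1 = Z by rewrite hy invrK -/Z; lra.
have ym : m < y.
  rewrite ltNge; apply/negP => ym.
  have := @hardcore_threshold R n lam y n0 l0 hl; rewrite NS -/m y0 ym => /(_ isT).
  rewrite yV /Z.
  have -> : 1 + lam * y ^+ n.+1 = a^-1 by rewrite ha invrK.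
  rewrite mulrAC -[lam * _ * _]mulrA -exprMn mulfV ?gt_eqF // expr1n mulr1.
  by apply/negP; rewrite -ltNge mulrBr mulr1 ltrBlDr ltrDl mulr_gt0.
pose t := 1 - c; rewrite -/t in cE; have Zt : Z = lam * a ^+ n.+1 * t by [].
have t0 : 0 < t by rewrite subr_gt0.
have t1 : t * (N + 4) <= 4.
  have xn1 : x ^+ n.+1 <= 1 by rewrite exprn_ile1 // ltW.
  have lN := activity_bound.
  have : lam * N * x ^+ n.+1 <= 4.
    by apply: le_trans lN; rewrite ler_piMr // mulr_ge0 // ltW.
  rewrite cE; have : c * (1 + lam * x ^+ n.+1) = 1 by rewrite hc mulVf // gt_eqF //; lra.
  by nra.
have hy' : (1 - y) * y ^+ n = t * ((1 - a) * a ^+ n).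
  by rewrite yE aE Zt !exprS; ring.
pose z := (N + 1) * (1 - y).
have y1 : y < 1 by rewrite -subr_gt0 yE mulr_gt0.
have z0 : 0 <= z by rewrite mulr_ge0 //; lra.
have z1 : z <= 1.
  by move: ym; rewrite /m ltr_pdivrMr /z; lra.
have mn0 : 0 < m ^+ n by rewrite exprn_gt0.
have hz : (2 - z) * z <= t.
  rewrite -(ler_pM2l mn0).
  have B : m ^+ n * (2 - z) <= y ^+ n.
    have /bernoulli_ineq : -1 <= y / m - 1.
      by rewrite lerBrDr addNr divr_ge0 // ltW.
    move=> /(_ n); rewrite [1 + (y / m - 1)]addrCA subrr addr0 expr_div_n -/N.
    rewrite ler_pdivlMr // => H; apply: le_trans H.
    rewrite [leRHS]mulrC ler_pM2l // le_eqVlt; apply/orP; left; apply/eqP.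
    by rewrite /z /m; field; rewrite !gt_eqF //; lra.
  rewrite mulrA; apply: (@le_trans _ _ (y ^+ n * z)); first by rewrite ler_wpM2r.
  have := hardcore_max a0.
  have -> : y ^+ n * z = t * (a ^+ n * (1 - a) * (N + 1)).
    by rewrite /z mulrCA [y ^+ n * _]mulrC hy'; ring.
  by rewrite [m ^+ n * t]mulrC ler_pM2l.
have gap : z * (1 + N * t) < 1 by apply: quadratic_gap => //; apply/andP.
pose q := ln x - ln y; pose r := ln a - ln c.
have q0 : 0 <= q by rewrite subr_ge0 ler_ln.
have rq : r <= t * ((N + 1) * q).
  have := ln1D_contraction Y0 X0.
  have -> : ln (1 + lam * x ^+ n.+1) = - ln c by rewrite hc lnV ?opprK // posrE; lra.
  have -> : ln (1 + lam * y ^+ n.+1) = - ln a by rewrite ha lnV ?opprK // posrE; lra.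
  have -> : lam * x ^+ n.+1 / (1 + lam * x ^+ n.+1) = t by rewrite cE hc.
  rewrite !ln_mulXn // NS; move=> H; apply: (le_trans (le_trans _ H)).
    by rewrite /r; lra.
  by rewrite le_eqVlt; apply/orP; left; apply/eqP; rewrite /q; ring.
have qr : q <= (1 - y) * (N * r + (N + 1) * q).
  have := ln1D_contraction W0 Z0.
  have -> : ln (1 + Z) = - ln y by rewrite hy -/Z lnV ?opprK // posrE; lra.
  have -> : ln (1 + W) = - ln x by rewrite hx -/W lnV ?opprK // posrE; lra.
  have -> : Z / (1 + Z) = 1 - y by rewrite yE hy.
  have -> : ln Z = ln lam + (N + 1) * ln a + (ln lam + (N + 1) * ln x + ln c).
    by rewrite Zt cE lnM ?posrE ?mulr_gt0 // [ln (_ * c)]lnM ?posrE // !ln_mulXn // NS.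
  have -> : ln W = ln lam + (N + 1) * ln c + (ln lam + (N + 1) * ln y + ln a).
    by rewrite /W aE lnM ?posrE ?mulr_gt0 // [ln (_ * a)]lnM ?posrE // !ln_mulXn // NS.
  move=> H; apply: (le_trans (le_trans _ H)); first by rewrite /q; lra.
  by rewrite le_eqVlt; apply/orP; left; apply/eqP; rewrite /q /r; ring.
have : q <= z * (1 + N * t) * q.
  apply: (le_trans qr); rewrite [leRHS](_ : _ = (1 - y) * (N * (t * ((N + 1) * q)) + (N + 1) * q)).
    apply: ler_wpM2l; first by rewrite subr_ge0 ltW.
    by apply: lerD => //; rewrite ler_wpM2l //; lra.
  by rewrite /z; ring.
move=> qq; have {qq} qe : q <= 0 by nra.
by apply: ln_inj; rewrite ?posrE //; apply/eqP; rewrite -subr_eq0 eq_le qe.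
Qed.

End TwoCycle.

Lemma cvg_exprn (R : realType) (u : nat -> R) (l : R) (k : nat) :
  (u i @[i --> \oo] --> l -> u i ^+ k @[i --> \oo] --> l ^+ k)%classic.
Proof.
move=> ul; elim: k => [|k IH].
  by under eq_fun do rewrite expr0; exact: cvg_cst.
by under eq_fun do rewrite exprS; rewrite exprS; exact: cvgM.
Qed.

(** * Homogeneous message bounds and their common limit *)

Section HomogeneousMessages.
Variables (R : realType) (n : nat) (lam : R).
Hypothesis (l0 : 0 < lam).

Definition hc_map (x : R) : R := (1 + lam * x ^+ n.+1)^-1.

Definition msg_map (p : R * R) : R * R :=
  ((1 + lam * p.2 ^+ n.+1 * (1 - hc_map p.1))^-1, hc_map p.1).

(** Lower and upper bounds for the message at the top of a subtree of depth k
    with arbitrary boundary; the map being antitone, each bound is the image of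
    the other one. *)
Fixpoint msg_bounds (k : nat) : (R * R) * (R * R) :=
  if k is k'.+1 then (msg_map (msg_bounds k').2, msg_map (msg_bounds k').1)
  else ((0, 0), (1, 1)).

Definition le_msg (p q : R * R) := p.1 <= q.1 /\ p.2 <= q.2.

Lemma hc_map_bounds x : 0 <= x -> 0 < hc_map x <= 1.
Proof.
move=> x0; have p0 : 0 <= lam * x ^+ n.+1 by rewrite mulr_ge0 ?exprn_ge0 // ltW.
by rewrite /hc_map invr_gt0 invf_le1; lra.
Qed.

Lemma hc_map_anti x y : 0 <= x -> x <= y -> hc_map y <= hc_map x.
Proof.
move=> x0 xy; have y0 : 0 <= y by apply: le_trans xy.
have h u : 0 <= u -> 0 < 1 + lam * u ^+ n.+1.
  by move=> u0; rewrite ltr_pwDl // mulr_ge0 ?exprn_ge0 // ltW.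
rewrite /hc_map lef_pV2 ?posrE ?h // lerD2l ler_pM2l //.
by rewrite lerXn2r // nnegrE.
Qed.

Lemma msg_map_ge0 p : le_msg (0, 0) p -> 0 < (msg_map p).1 <= 1 /\ 0 < (msg_map p).2 <= 1.
Proof.
case: p => x g [/= x0 g0]; have h := hc_map_bounds x0; split => //.
case/andP: h => h0 h1.
have p0 : 0 <= lam * g ^+ n.+1 * (1 - hc_map x).
  by rewrite !mulr_ge0 ?exprn_ge0 ?subr_ge0 // ltW.
by rewrite invr_gt0 invf_le1; lra.
Qed.

Lemma msg_map_anti p q : le_msg (0, 0) p -> le_msg p q -> le_msg (msg_map q) (msg_map p).
Proof.
case: p q => [x g] [x' g'] [/= x0 g0] [/= xx gg].
have x'0 := le_trans x0 xx; have g'0 := le_trans g0 gg.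
have hh := hc_map_anti x0 xx; split => //=.
have /andP[h0 h1] := hc_map_bounds x0; have /andP[h0' h1'] := hc_map_bounds x'0.
have p u v : 0 <= u -> v <= 1 -> 0 < 1 + lam * u ^+ n.+1 * (1 - v).
  move=> u0 v1; rewrite ltr_pwDl // !mulr_ge0 ?exprn_ge0 ?subr_ge0 //; exact: ltW.
rewrite lef_pV2 ?posrE ?p // lerD2l.
apply: ler_pM; rewrite ?subr_ge0 ?lerB //.
  by rewrite mulr_ge0 ?exprn_ge0 // ltW.
by rewrite ler_pM2l // lerXn2r // nnegrE.
Qed.

Lemma msg_bounds_inv k :
  [/\ le_msg (0, 0) (msg_bounds k).1, le_msg (msg_bounds k).1 (msg_bounds k.+1).1,
      le_msg (msg_bounds k.+1).1 (msg_bounds k.+1).2,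
      le_msg (msg_bounds k.+1).2 (msg_bounds k).2 & le_msg (msg_bounds k).2 (1, 1)].
Proof.
have tr p q r : le_msg p q -> le_msg q r -> le_msg p r.
  by move=> [? ?] [? ?]; split; apply: le_trans; eauto.
have pos p : le_msg (0, 0) p -> le_msg (0, 0) (msg_map p) /\ le_msg (msg_map p) (1, 1).
  by case/msg_map_ge0 => /andP[? ?] /andP[? ?]; split; split => //; apply: ltW.
have z1 : le_msg (0, 0) (1, 1) by split; exact: ler01.
elim: k => [|k [h1 h2 h3 h4 h5]].
  have [a1 a2] := pos _ z1; have [b1 b2] := pos (0, 0) (conj (lexx _) (lexx _)).
  by split; [split; exact: lexx|exact: a1|exact: msg_map_anti|exact: b2|split; exact: lexx].
have l1 := tr _ _ _ h1 h2.
have u1 := tr _ _ _ l1 h3.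
have [_ c2] := pos _ h1.
by split; [exact: l1|exact: msg_map_anti|exact: msg_map_anti|exact: msg_map_anti|exact: c2].
Qed.

Hypothesis n0 : (0 < n)%N.
Hypothesis hl : lam * (n%:R / n.+1%:R) ^+ n.+1 * n%:R <= 1.

Local Open Scope classical_set_scope.

(** Both bounds are monotone, so they converge, to a 2-cycle, hence to the same
    fixed point.  The convergence is stated in ratio form because messages only
    matter up to a scalar. *)
Lemma msg_limit : exists p : R * R,
  [/\ 0 < p.1, 0 < p.2, msg_map p = p &
   forall rho, 1 < rho -> exists k,
     [/\ p.1 <= rho * (msg_bounds k).1.1, p.2 <= rho * (msg_bounds k).1.2,
         (msg_bounds k).2.1 <= rho * p.1 & (msg_bounds k).2.2 <= rho * p.2]].
Proof.
have inc (u : R^nat) : (forall k, u k <= u k.+1) -> (forall k, u k <= 1) ->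
    exists l : R, u @ \oo --> l /\ forall k, u k <= l.
  move=> ui u1; have nd : nondecreasing_seq u by apply/nondecreasing_seqP.
  have cu : cvgn u.
    apply: nondecreasing_is_cvgn => //.
    by exists 1 => _ [k _ <-].
  by exists (limn u); split => // k; apply: nondecreasing_cvgn_le.
have dec (u : R^nat) : (forall k, u k.+1 <= u k) -> (forall k, 0 <= u k) ->
    exists l : R, u @ \oo --> l /\ forall k, l <= u k.
  move=> ui u1; have nd : nonincreasing_seq u by apply/nonincreasing_seqP.
  have cu : cvgn u.
    apply: nonincreasing_is_cvgn => //.
    by exists 0 => _ [k _ <-].
  by exists (limn u); split => // k; apply: nonincreasing_cvgn_ge.
have I := msg_bounds_inv.
have le01 k : le_msg (msg_bounds k).1 (msg_bounds k).2.
  by case: k => [|k]; [split; exact: ler01|have [] := I k].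
have [||y [yc yk]] := inc (fun k => (msg_bounds k).1.1).
- by move=> k; have [_ []] := I k.
- by move=> k; have [_ _ _ _ []] := I k; have [] := le01 k => + _ + _; exact: le_trans.
have [||c [cc ck]] := inc (fun k => (msg_bounds k).1.2).
- by move=> k; have [_ []] := I k.
- by move=> k; have [_ _ _ _ [_]] := I k; have [_] := le01 k; exact: le_trans.
have [||x [xc xk]] := dec (fun k => (msg_bounds k).2.1).
- by move=> k; have [_ _ _ []] := I k.
- by move=> k; have [[+ _] _ _ _ _] := I k; have [+ _] := le01 k => /[swap]; exact: le_trans.
have [||a [ac ak]] := dec (fun k => (msg_bounds k).2.2).
- by move=> k; have [_ _ _ []] := I k.
- by move=> k; have [[_ +] _ _ _ _] := I k; have [_ +] := le01 k => /[swap]; exact: le_trans.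
have [l1 l2] : 0 < (msg_bounds 1).1.1 /\ 0 < (msg_bounds 1).1.2.
  have z1 : le_msg (0, 0) (1, 1) by split; exact: ler01.
  by have [/andP[? _] /andP[? _]] := msg_map_ge0 z1.
have y0 : 0 < y := lt_le_trans l1 (yk 1%N).
have c0 : 0 < c := lt_le_trans l2 (ck 1%N).
have yx : y <= x.
  apply: (ler_cvg_to yc xc); near=> k.
  by have [] := le01 k.
have ca : c <= a.
  apply: (ler_cvg_to cc ac); near=> k.
  by have [] := le01 k.
have x1 : x <= 1 := xk 0%N.
have x0 : 0 < x := lt_le_trans y0 yx.
have a0 : 0 < a := lt_le_trans c0 ca.
have pd (u : R) : 0 <= u -> 1 + lam * u ^+ n.+1 != 0.
  by move=> u0; rewrite gt_eqF // ltr_pwDl // mulr_ge0 ?exprn_ge0 // ltW.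
have hcl (u : R^nat) (l : R) : 0 <= l -> u @ \oo --> l -> (fun k => hc_map (u k)) @ \oo --> hc_map l.
  move=> l'0 ul; apply: cvgV; first exact: pd.
  by apply: cvgD; [exact: cvg_cst|apply: cvgM; [exact: cvg_cst|exact: cvg_exprn]].
have msl (u v : R^nat) (l l' : R) : 0 <= l -> 0 <= l' -> u @ \oo --> l -> v @ \oo --> l' ->
    (fun k => (1 + lam * v k ^+ n.+1 * (1 - hc_map (u k)))^-1) @ \oo -->
    (1 + lam * l' ^+ n.+1 * (1 - hc_map l))^-1.
  move=> l_0 l'0 ul vl; apply: cvgV.
    have /andP[_ h1] := hc_map_bounds l_0.
    by rewrite gt_eqF // ltr_pwDl // !mulr_ge0 ?exprn_ge0 ?subr_ge0 // ltW.
  apply: cvgD; first exact: cvg_cst.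
  apply: cvgM; first by apply: cvgM; [exact: cvg_cst|exact: cvg_exprn].
  by apply: cvgB; [exact: cvg_cst|exact: hcl].
have shift (u : R^nat) (l : R) : u @ \oo --> l -> (fun k => u k.+1) @ \oo --> l.
  by move=> h; rewrite (@cvg_shiftS _ u).
have hc' : c = hc_map x.
  by apply: (cvg_unique _ (shift _ _ cc)) => //; apply: hcl => //; exact: ltW.
have ha : a = hc_map y.
  by apply: (cvg_unique _ (shift _ _ ac)) => //; apply: hcl => //; exact: ltW.
have hy : y = (1 + lam * a ^+ n.+1 * (1 - c))^-1.
  rewrite hc'; apply: (cvg_unique _ (shift _ _ yc)) => //.
  by apply: msl => //; exact: ltW.
have hx : x = (1 + lam * c ^+ n.+1 * (1 - a))^-1.
  rewrite ha; apply: (cvg_unique _ (shift _ _ xc)) => //.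
  by apply: msl => //; exact: ltW.
have xy := two_cycle_trivial n0 l0 hl y0 yx x1 hc' ha hy hx.
have acE : a = c by rewrite ha hc' xy.
exists (y, c); split => //=.
  rewrite /msg_map /= -xy -hc'; congr (_, _).
  by rewrite [RHS]hx acE.
move=> rho r1.
have near1 (u : R^nat) (l : R) : 0 < l -> u @ \oo --> l -> \forall k \near \oo, l <= rho * u k.
  move=> l_0 ul.
  have : (fun k => rho * u k) @ \oo --> rho * l by apply: cvgM => //; exact: cvg_cst.
  have lt : l < rho * l by rewrite ltr_pMl.
  by move=> /cvgr_gt /(_ _ lt); apply: filterS => k /ltW.
have near2 (u : R^nat) (l : R) : 0 < l -> u @ \oo --> l -> \forall k \near \oo, u k <= rho * l.
  move=> l_0 ul.
  have lt : l < rho * l by rewrite ltr_pMl.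
  by move: ul => /cvgr_lt /(_ _ lt); apply: filterS => k /ltW.
have := near1 _ _ y0 yc; have := near1 _ _ c0 cc.
have := near2 _ _ x0 xc; have := near2 _ _ a0 ac.
rewrite xy acE => A B C D.
have /filter_ex [k [? ? ? ?]] : \forall k \near \oo,
  [/\ y <= rho * (msg_bounds k).1.1, c <= rho * (msg_bounds k).1.2,
    (msg_bounds k).2.1 <= rho * y & (msg_bounds k).2.2 <= rho * c].
  by near=> k; split; near: k.
by exists k.
Unshelve. all: by end_near.
Qed.

End HomogeneousMessages.

(** * Sums over blocks of coordinates *)
Definition upd (s : nat -> 'I_3) (m : nat) (a : 'I_3) : nat -> 'I_3 :=
  fun i => if i == m then a else s i.

Lemma upd_eq s m a : upd s m a m = a. Proof. by rewrite /upd eqxx. Qed.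

Lemma upd_neq s m a i : i != m -> upd s m a i = s i.
Proof. by rewrite /upd => /negbTE ->. Qed.

Section SumCoord.
Variable R : realType.
Implicit Types (F G : (nat -> 'I_3) -> R) (s : nat -> 'I_3).

(** Sum over all values of the coordinates m, ..., m+k-1 of a configuration,
    the others being kept.  All configurations are full sequences, so that blocks of
    different sizes can be summed out in turn without changing type. *)
Fixpoint sumc (k m : nat) F s : R :=
  if k is k'.+1 then \sum_(a : 'I_3) sumc k' m.+1 F (upd s m a) else F s.

Lemma sumc_le k m F G s : (forall t, (forall i, (i < m)%N -> t i = s i) ->
  (forall i, (m + k <= i)%N -> t i = s i) -> F t <= G t) ->
  sumc k m F s <= sumc k m G s.
Proof.
elim: k m s => [|k IH] m s H /=; first exact: H.
apply: ler_sum => a _; apply: IH => t h1 h2; apply: H => i im.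
  by rewrite h1 ?upd_neq ?ltn_eqF // ltnW.
rewrite h2; last by move: im; rewrite addnS.
by rewrite upd_neq // gtn_eqF //; lia.
Qed.

Lemma eq_sumc k m F G s : (forall t, (forall i, (i < m)%N -> t i = s i) ->
  (forall i, (m + k <= i)%N -> t i = s i) -> F t = G t) ->
  sumc k m F s = sumc k m G s.
Proof.
by move=> H; apply/eqP; rewrite eq_le; apply/andP; split; apply: sumc_le => t h1 h2;
  rewrite H.
Qed.

Lemma sumcZ c k m F s : sumc k m (fun t => c * F t) s = c * sumc k m F s.
Proof.
elim: k m s => [//|k IH] m s /=; rewrite mulr_sumr.
by apply: eq_bigr => a _; rewrite IH.
Qed.

Lemma sumcD k k' m F s : sumc (k + k') m F s = sumc k m (sumc k' (m + k) F) s.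
Proof.
elim: k m s => [|k IH] m s /=; first by rewrite addn0.
by apply: eq_bigr => a _; rewrite IH addSnnS.
Qed.

Lemma upd_comm s i j a c : i != j -> upd (upd s i a) j c = upd (upd s j c) i a.
Proof.
move=> ij; apply/funext => x; rewrite /upd.
by case: eqP => // ->; case: eqP => // e; rewrite e eqxx in ij.
Qed.

Lemma sumc_comm k k' m m' F s : (m + k <= m')%N ->
  sumc k m (sumc k' m' F) s = sumc k' m' (sumc k m F) s.
Proof.
have one j c l p G t : (j < p)%N -> sumc l p G (upd t j c) = sumc l p (fun t => G (upd t j c)) t.
  elim: l p t => [//|l IH] p t jp /=; apply: eq_bigr => a _.
  by rewrite upd_comm ?ltn_eqF // IH // ltnW.
have sw l p G (H : 'I_3 -> (nat -> 'I_3) -> R) t :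
    \sum_a sumc l p (H a) t = sumc l p (fun t => \sum_a H a t) t.
  elim: l p t => [//|l IH] p t /=; rewrite exchange_big /=.
  by apply: eq_bigr => a _; rewrite IH.
elim: k m s => [//|k IH] m s mm' /=.
have mlt : (m < m')%N by lia.
have mm1 : (m.+1 + k <= m')%N by lia.
under eq_bigr do rewrite (IH _ _ mm1) (one _ _ _ _ _ _ mlt).
by rewrite sw.
Qed.

End SumCoord.

(** * Weights on the heap-numbered tree *)

(** The root is given a virtual parent of spin 0: it imposes no constraint, and
    the cut above the root is treated as any other cut. *)
Definition parent_spin (n : nat) (s : nat -> 'I_3) (v : nat) : nat :=
  if v is v'.+1 then s (v' %/ n.+1)%N else 0%N.

Definition edge_ok (n : nat) (s : nat -> 'I_3) (v : nat) : bool :=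
  (s v + parent_spin n s v <= 2)%N.

Lemma parent_spin_upd n s m a v : (v <= n.+1 * m)%N ->
  parent_spin n (upd s m a) v = parent_spin n s v.
Proof.
case: v => [//|v] vm /=; rewrite upd_neq // ltn_eqF // ltn_divLR //.
by rewrite mulnC.
Qed.

Lemma parent_spin_child n s m i : (i < n.+1)%N ->
  parent_spin n s (n.+1 * m + i).+1 = s m.
Proof. by move=> ib /=; rewrite mulnC divnMDl // divn_small // addn0. Qed.

Section Heap.
Variables (R : realType) (n : nat) (lam : R).
Implicit Types (s t : nat -> 'I_3) (r : nat -> nat -> R).

Definition heap_weight (m : nat) s : R :=
  \prod_(0 <= v < m) (lam ^+ s v * (edge_ok n s v)%:R).

(** Weight of a configuration on the first m vertices when every edge leaving
    this initial segment carries a message: the vertices in m, ..., b*m are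
    exactly those whose parent, possibly virtual, lies in the segment and that
    do not lie in it themselves. *)
Definition cut_weight r (m : nat) s : R :=
  heap_weight m s * \prod_(m <= v < (n.+1 * m).+1) r v (parent_spin n s v).

(** The message sent by m to its parent of spin j, given the messages r sent by
    the children of m. *)
Definition msg_rec r (m : nat) (j : nat) : R :=
  \sum_(a : 'I_3 | (a + j <= 2)%N)
    lam ^+ a * \prod_(i < n.+1) r (n.+1 * m + i).+1 a.

Lemma heap_weight_upd m s a :
  heap_weight m.+1 (upd s m a) =
  heap_weight m s * (lam ^+ a * (a + parent_spin n s m <= 2)%N%:R).
Proof.
rewrite /heap_weight big_nat_recr //= /edge_ok upd_eq parent_spin_upd; last by lia.
congr (_ * _); apply: eq_big_nat => v /andP[_ vm].
by rewrite parent_spin_upd ?upd_neq ?ltn_eqF //; nia.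
Qed.

(** Summing out vertex m replaces the b messages of its children by the message
    of m. *)
Lemma cut_weight_elim r r' m s :
  (forall v, (m < v)%N -> r' v = r v) ->
  (forall j, (j <= 2)%N -> r' m j = msg_rec r m j) ->
  \sum_(a : 'I_3) cut_weight r m.+1 (upd s m a) = cut_weight r' m s.
Proof.
move=> rr rm; rewrite /cut_weight.
have mb : (m < (n.+1 * m).+1)%N by nia.
have sp2 : (parent_spin n s m <= 2)%N by case: (m) => //= k; rewrite -ltnS.
rewrite [in RHS]big_ltn // rm // /msg_rec mulrA mulr_sumr mulr_suml.
rewrite [RHS]big_mkcond /=; apply: eq_bigr => a _.
rewrite heap_weight_upd; case: ifP => [_|_]; last by rewrite !mulr0 mul0r.
rewrite mulr1 -!mulrA; congr (_ * (_ * _)).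
rewrite (@big_cat_nat _ _ _ (n.+1 * m).+1) /=; [|by nia|by nia].
rewrite mulrC; congr (_ * _).
  have -> : (n.+1 * m.+1).+1 = (n.+1 + (n.+1 * m).+1)%N by lia.
  rewrite -{1}[(n.+1 * m).+1]add0n big_addn addnK big_mkord.
  apply: eq_bigr => i _; rewrite addnS addnC parent_spin_child ?upd_eq //.
apply: eq_big_nat => v /andP[mv vm].
by rewrite rr // parent_spin_upd.
Qed.

Lemma parent_spin_ext s t m v : (v < m)%N -> (forall i, (i < m)%N -> s i = t i) ->
  parent_spin n s v = parent_spin n t v.
Proof.
case: v => [//|v] vm H /=; rewrite H // (leq_ltn_trans (leq_div _ _)) //.
exact: ltnW.
Qed.

Lemma heap_weight_ext m s t : (forall i, (i < m)%N -> s i = t i) ->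
  heap_weight m s = heap_weight m t.
Proof.
move=> H; apply: eq_big_nat => v /andP[_ vm].
by rewrite /edge_ok (parent_spin_ext vm H) H.
Qed.

Lemma cut_weight_ext r r' m s t : (forall i, (i < m)%N -> s i = t i) ->
  (forall v j, (m <= v <= n.+1 * m)%N -> r v j = r' v j) ->
  cut_weight r m s = cut_weight r' m t.
Proof.
move=> H rr; rewrite /cut_weight (heap_weight_ext H); congr (_ * _).
apply: eq_big_nat => v vm; rewrite rr //; congr (r' _ _).
case: v vm => [//|v] /andP[_ vm] /=; rewrite H // ltn_divLR //; nia.
Qed.

(** Messages when the configuration s is prescribed from vertex N on, after the
    last d vertices below N have been summed out.  The vertices are treated
    in decreasing order, so each one finds its children already done. *)
Fixpoint msg (s : nat -> 'I_3) (N d : nat) : nat -> nat -> R :=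
  if d is d'.+1 then
    fun v => if v == (N - d'.+1)%N then msg_rec (msg s N d') v else msg s N d' v
  else fun v j => (s v + j <= 2)%N%:R.

Lemma sumc_msg z N d s : (d <= N)%N ->
  sumc d (N - d) (cut_weight (msg z N 0) N) s = cut_weight (msg z N d) (N - d) s.
Proof.
elim: d s => [|d IH] s dN; first by rewrite /= subn0.
have e : (N - d.+1).+1 = (N - d)%N by lia.
transitivity (\sum_(a : 'I_3) sumc d (N - d.+1).+1 (cut_weight (msg z N 0) N) (upd s (N - d.+1) a)).
  by [].
under eq_bigr do rewrite {1}e IH 1?ltnW // -e.
apply: cut_weight_elim => [v Nv|j _] /=.
  by rewrite gtn_eqF.
by rewrite eqxx.
Qed.

(** Bounds lu = (lower, upper) on the ratios S 1 / S 0 and S 2 / S 1, without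
    division because S 1 vanishes when a neighbour of spin 2 is prescribed. *)
Definition in_bounds (lu : (R * R) * (R * R)) (S : nat -> R) : Prop :=
  [/\ 0 < S 0%N, lu.1.1 * S 0%N <= S 1%N <= lu.2.1 * S 0%N &
      lu.1.2 * S 1%N <= S 2%N <= lu.2.2 * S 1%N].

Lemma sum_compatible_spins (j : nat) (F : 'I_3 -> R) : (j <= 2)%N ->
  \sum_(a : 'I_3 | (a + j <= 2)%N) F a =
  F ord0 + (if (j <= 1)%N then F (inord 1) else 0) + (if j == 0%N then F (inord 2) else 0).
Proof.
move=> j2; rewrite big_mkcond !big_ord_recl big_ord0 /= addr0 add0n j2 -addrA.
have -> : lift ord0 ord0 = inord 1 :> 'I_3 by apply/val_inj; rewrite /= inordK.
have -> : lift ord0 (lift ord0 ord0) = inord 2 :> 'I_3 by apply/val_inj; rewrite /= inordK.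
by case: j j2 => [|[|[]]].
Qed.

Lemma prod_scaled_le (u : R) (S : 'I_n.+1 -> R) (T : 'I_n.+1 -> R) : 0 <= u ->
  (forall i, 0 <= S i) -> (forall i, u * S i <= T i) ->
  u ^+ n.+1 * \prod_i S i <= \prod_i T i.
Proof.
move=> u0 S0 ST; have -> : u ^+ n.+1 * \prod_i S i = \prod_i (u * S i).
  by rewrite big_split /= prodr_const card_ord.
by apply: ler_prod => i _; rewrite mulr_ge0 // ST.
Qed.

Lemma prod_le_scaled (u : R) (S : 'I_n.+1 -> R) (T : 'I_n.+1 -> R) :
  (forall i, 0 <= T i) -> (forall i, T i <= u * S i) ->
  \prod_i T i <= u ^+ n.+1 * \prod_i S i.
Proof.
move=> S0 ST; have -> : u ^+ n.+1 * \prod_i S i = \prod_i (u * S i).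
  by rewrite big_split /= prodr_const card_ord.
by apply: ler_prod => i _; rewrite S0 ST.
Qed.

Hypothesis l0 : 0 < lam.

Lemma heap_weight_ge0 m s : 0 <= heap_weight m s.
Proof. by apply: prodr_ge0 => v _; rewrite mulr_ge0 ?ler0n // exprn_ge0 // ltW. Qed.

(** If A j is the product over the children of their messages S j, the new
    ratios are functions of lam * A 1 / A 0 and lam * A 2 / A 1 that are
    nonincreasing in both, and these products are controlled factor by factor. *)
Lemma in_bounds_rec r m l u : le_msg (0, 0) l -> le_msg l u ->
  (forall i : 'I_n.+1, in_bounds (l, u) (r (n.+1 * m + i).+1)) ->
  in_bounds (msg_map n lam u, msg_map n lam l) (msg_rec r m).
Proof.
move=> [/= l1 l2] [/= lu1 lu2] H.
have u1 := le_trans l1 lu1; have u2 := le_trans l2 lu2.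
pose S j (i : 'I_n.+1) := r (n.+1 * m + i).+1 j.
have S0 i : 0 < S 0%N i by have [] := H i.
have S1 i : 0 <= S 1%N i.
  by have [h /andP[/= + _] _] := H i; apply: le_trans; rewrite mulr_ge0 // ltW.
have S2 i : 0 <= S 2%N i.
  by have [_ _ /andP[/= + _]] := H i; apply: le_trans; rewrite mulr_ge0 // S1.
pose P j := \prod_i S j i.
have P0 : 0 < P 0%N by apply: prodr_gt0.
have P1 : 0 <= P 1%N by apply: prodr_ge0.
have P2 : 0 <= P 2%N by apply: prodr_ge0.
have a1 : l.1 ^+ n.+1 * P 0%N <= P 1%N.
  by apply: prod_scaled_le => // i; [exact: ltW|have [_ /andP[]] := H i].
have a2 : P 1%N <= u.1 ^+ n.+1 * P 0%N.
  by apply: prod_le_scaled => // i; have [_ /andP[]] := H i.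
have a3 : l.2 ^+ n.+1 * P 1%N <= P 2%N.
  by apply: prod_scaled_le => // i; have [_ _ /andP[]] := H i.
have a4 : P 2%N <= u.2 ^+ n.+1 * P 1%N.
  by apply: prod_le_scaled => // i; have [_ _ /andP[]] := H i.
have E j : (j <= 2)%N -> msg_rec r m j =
    P 0%N + (if (j <= 1)%N then lam * P 1%N else 0) + (if j == 0%N then lam ^+ 2 * P 2%N else 0).
  by move=> j2; rewrite /msg_rec sum_compatible_spins // !inordK //= expr0 expr1 mul1r.
rewrite /in_bounds !E //= !addr0 /msg_map /hc_map /=.
have L1 : 0 <= lam * l.1 ^+ n.+1 by rewrite mulr_ge0 ?exprn_ge0 // ltW.
have U1 : 0 <= lam * u.1 ^+ n.+1 by rewrite mulr_ge0 ?exprn_ge0 // ltW.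
have L2 : 0 <= lam * l.2 ^+ n.+1 by rewrite mulr_ge0 ?exprn_ge0 // ltW.
have U2 : 0 <= lam * u.2 ^+ n.+1 by rewrite mulr_ge0 ?exprn_ge0 // ltW.
have b1 : lam * l.1 ^+ n.+1 * P 0%N <= lam * P 1%N by rewrite -mulrA ler_pM2l.
have b2 : lam * P 1%N <= lam * u.1 ^+ n.+1 * P 0%N by rewrite -[leRHS]mulrA ler_pM2l.
have b3 : lam * l.2 ^+ n.+1 * (lam * P 1%N) <= lam ^+ 2 * P 2%N.
  by rewrite [leLHS](_ : _ = lam ^+ 2 * (l.2 ^+ n.+1 * P 1%N)); [rewrite ler_pM2l ?exprn_gt0|ring].
have b4 : lam ^+ 2 * P 2%N <= lam * u.2 ^+ n.+1 * (lam * P 1%N).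
  by rewrite [leRHS](_ : _ = lam ^+ 2 * (u.2 ^+ n.+1 * P 1%N)); [rewrite ler_pM2l ?exprn_gt0|ring].
have M1 : 0 <= lam * P 1%N by rewrite mulr_ge0 // ltW.
have M2 : 0 <= lam ^+ 2 * P 2%N by rewrite mulr_ge0 // exprn_ge0 // ltW.
move: (P 0%N) (lam * P 1%N) (lam ^+ 2 * P 2%N) P0 M1 M2 b1 b2 b3 b4 => p0 m1 m2 P0' M1 M2 b1 b2 b3 b4.
move: (lam * l.1 ^+ n.+1) (lam * u.1 ^+ n.+1) (lam * l.2 ^+ n.+1) (lam * u.2 ^+ n.+1) L1 U1 L2 U2 b1 b2 b3 b4 =>
  A B C D A0 B0 C0 D0 b1 b2 b3 b4.
have A1 : 0 < 1 + A by lra.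
have B1 : 0 < 1 + B by lra.
have hA : 1 - (1 + A)^-1 = A / (1 + A) by field; rewrite gt_eqF.
have hB : 1 - (1 + B)^-1 = B / (1 + B) by field; rewrite gt_eqF.
rewrite hA hB.
have cA : A / (1 + A) * (p0 + m1) <= m1.
  by rewrite mulrAC ler_pdivrMr //; lra.
have cB : m1 <= B / (1 + B) * (p0 + m1).
  by rewrite mulrAC ler_pdivlMr //; lra.
have AA : 0 <= A / (1 + A) by rewrite divr_ge0 // ltW.
have BB : 0 <= B / (1 + B) by rewrite divr_ge0 // ltW.
have DB : 0 < 1 + D * (B / (1 + B)) by rewrite ltr_pwDl // mulr_ge0.
have CA : 0 < 1 + C * (A / (1 + A)) by rewrite ltr_pwDl // mulr_ge0.
split; first by lra.
  rewrite ler_pdivrMl // ler_pdivlMl //; apply/andP; split.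
    have : m2 <= D * (B / (1 + B) * (p0 + m1)) by apply: (le_trans b4); rewrite ler_wpM2l.
    by lra.
  have : C * (A / (1 + A) * (p0 + m1)) <= m2 by apply: le_trans b3; rewrite ler_wpM2l.
  by lra.
by rewrite ler_pdivrMl // ler_pdivlMl //; apply/andP; split; lra.
Qed.

End Heap.

(** Last vertex at depth k below v, in the heap numbering. *)
Definition reach (n k v : nat) : nat := iter k (fun u => n.+1 * u + n.+1)%N v.

Lemma reach_mono n k u v : (u <= v)%N -> (reach n k u <= reach n k v)%N.
Proof. by elim: k => [//|k IH] uv; rewrite /reach !iterS leq_add2r leq_mul2l IH ?orbT. Qed.

Lemma reachS n k v : reach n k.+1 v = reach n k (n.+1 * v + n.+1)%N.
Proof. by rewrite /reach iterSr. Qed.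

Lemma reach_ge n k v : (v + k <= reach n k v)%N.
Proof. by elim: k => [|k IH]; rewrite ?addn0 // /reach iterS -/(reach n k v); nia. Qed.

Lemma le_expr_limit (R : realType) (X Y : R) (K : nat) :
  (forall c, 1 < c -> X <= c ^+ K * Y) -> X <= Y.
Proof.
move=> H.
have c1 : ((1 + harmonic i) @[i --> \oo] --> (1 + 0 : R))%classic.
  by apply: cvgD; [exact: cvg_cst|exact: cvg_harmonic].
have c2 : (((1 + harmonic i) ^+ K * Y) @[i --> \oo] --> ((1 + 0) ^+ K * Y : R))%classic.
  by apply: cvgM; [exact: cvg_exprn|exact: cvg_cst].
rewrite addr0 expr1n mul1r in c2.
apply: (ler_cvg_to (f := fun=> X) (cvg_cst X) c2).
by apply: nearW => i; apply: H; rewrite ltrDl harmonic_gt0.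
Qed.

Section MessageSandwich.
Variables (R : realType) (n : nat) (lam : R).
Hypothesis (l0 : 0 < lam).
Implicit Types (s t : nat -> 'I_3) (r : nat -> nat -> R).

(** The last hypothesis puts the prescribed vertices below v at distance at
    least k from v.  For k = 0 it asks nothing: the bounds then only say that
    messages are positive at 0 and decrease with the spin. *)
Lemma msg_in_bounds s N d v k : (d <= N)%N -> (N - d <= v)%N ->
  ((0 < k)%N -> (reach n k v <= N)%N) ->
  in_bounds (msg_bounds n lam k) (msg n lam s N d v).
Proof.
elim: d v k => [|d IH] v k dN dv kv.
  case: k kv => [_|k /(_ isT) kv]; last by have := reach_ge n k.+1 v; lia.
  have sv : (s v <= 2)%N by rewrite -ltnS.
  by split => /=; rewrite ?addn0 ?sv ?mul0r ?mul1r ?ler0n ?ler_nat //=; lia.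
rewrite /=; case: eqP => [vE|vN]; last by apply: IH => //; lia.
have ch k' (i : 'I_n.+1) : ((0 < k')%N -> (reach n k' (n.+1 * v + i).+1 <= N)%N) ->
    in_bounds (msg_bounds n lam k') (msg n lam s N d (n.+1 * v + i).+1).
  by apply: IH; [exact: ltnW|lia].
case: k kv => [_|k /(_ isT) kv].
  have z : le_msg (0, 0) ((0, 0) : R * R) by split; exact: lexx.
  have z1 : le_msg (0, 0) ((1, 1) : R * R) by split; exact: ler01.
  have [P0 P1 P2] := in_bounds_rec l0 z z1 (fun i => ch 0%N i (fun h => False_ind _ (notF h))).
  have [_ [/= a1 a2] _ [/= b1 b2] _] := msg_bounds_inv n l0 0.
  have S1 : 0 <= msg_rec n lam (msg n lam s N d) v 1.
    by have /andP[+ _] := P1; apply: le_trans; rewrite mulr_ge0 // ltW.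
  split => //=; rewrite !mul0r ?mul1r; apply/andP; split => //.
  - have /andP[_ /le_trans] := P1; apply.
    by rewrite ler_piMl // ltW.
  - by have /andP[+ _] := P2; apply: le_trans; rewrite mulr_ge0.
  - have /andP[_ /le_trans] := P2; apply.
    by rewrite ler_piMl.
have [a0 a1 a2 a3 a4] := msg_bounds_inv n l0 k.
have le : le_msg (msg_bounds n lam k).1 (msg_bounds n lam k).2.
  case: a1 a2 a3 => [? ?] [? ?] [? ?].
  by split; apply: le_trans; eauto; apply: le_trans; eauto.
apply: in_bounds_rec => // i.
rewrite -surjective_pairing; apply: ch => _.
rewrite reachS in kv; apply: leq_trans kv; apply: reach_mono.
by rewrite -addnS leq_add2l.
Qed.

(** The message with S 1 / S 0 = p.1 and S 2 / S 1 = p.2, normalised by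
    S 0 = 1. *)
Definition ratio (p : R * R) (j : nat) : R :=
  match j with 0 => 1 | 1 => p.1 | _ => p.1 * p.2 end.

Lemma in_bounds_ratio (p : R * R) (rho : R) lu S j :
  0 < p.1 -> 0 < p.2 -> 1 < rho -> le_msg (0, 0) lu.1 ->
  p.1 <= rho * lu.1.1 -> p.2 <= rho * lu.1.2 ->
  lu.2.1 <= rho * p.1 -> lu.2.2 <= rho * p.2 ->
  in_bounds lu S -> (j <= 2)%N ->
  [/\ 0 <= S j, S 0%N * ratio p j <= rho ^+ 2 * S j & S j <= rho ^+ 2 * (S 0%N * ratio p j)].
Proof.
move=> p1 p2 r1 [/= z1 z2] h1 h2 h3 h4 [S0 /andP[s1 s1'] /andP[s2 s2']] j2.
have S1 : 0 <= S 1%N by apply: le_trans s1; rewrite mulr_ge0 // ltW.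
have S2 : 0 <= S 2%N by apply: le_trans s2; rewrite mulr_ge0.
have c1 : S 0%N * p.1 <= rho * S 1%N.
  apply: (@le_trans _ _ (S 0%N * (rho * lu.1.1))); first by rewrite ler_pM2l.
  by rewrite mulrCA ler_pM2l; [rewrite mulrC|lra].
have c1' : S 1%N <= rho * (S 0%N * p.1).
  apply: (le_trans s1'); rewrite mulrC mulrCA ler_pM2l //.
have c2 : S 1%N * p.2 <= rho * S 2%N.
  apply: (@le_trans _ _ (S 1%N * (rho * lu.1.2))); first by rewrite ler_wpM2l.
  by rewrite mulrCA ler_pM2l; [rewrite mulrC|lra].
have c2' : S 2%N <= rho * (S 1%N * p.2).
  by apply: (le_trans s2'); rewrite mulrC mulrCA ler_wpM2l.
have rr x : 0 <= x -> x <= rho * x by move=> x0; rewrite ler_peMl // ltW.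
have r0 : 0 < rho by lra.
case: j j2 => [|[|[|//]]] _ /=; rewrite expr2 -?mulrA.
- split; first exact: ltW.
    by rewrite mulr1; apply: (le_trans (rr _ (ltW S0))); apply: rr; rewrite mulr_ge0 // ltW.
  by rewrite mulr1; apply: (le_trans (rr _ (ltW S0))); apply: rr; rewrite mulr_ge0 // ltW.
- split => //.
    by apply: (le_trans c1); apply: rr; rewrite mulr_ge0 // ltW.
  by apply: (le_trans c1'); apply: rr; rewrite !mulr_ge0 // ltW.
- split => //.
    rewrite mulrA; apply: (@le_trans _ _ (rho * S 1%N * p.2)); first by rewrite ler_pM2r.
    by rewrite -mulrA ler_pM2l.
  apply: (le_trans c2'); rewrite ler_pM2l // mulrA mulrA [leRHS](_ : _ = rho * (S 0%N * p.1) * p.2).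
    by rewrite ler_pM2r.
  by rewrite !mulrA.
Qed.

(** Replacing all messages by the fixed point costs a bounded power of rho and
    the scalar K, which is common to all configurations and will cancel. *)
Lemma cut_weight_sandwich (p : R * R) (rho : R) (r : nat -> nat -> R) m s : 
  (forall v j, (m <= v <= n.+1 * m)%N -> (j <= 2)%N ->
    [/\ 0 <= r v j, r v 0%N * ratio p j <= rho * r v j & r v j <= rho * (r v 0%N * ratio p j)]) ->
  0 < p.1 -> 0 < p.2 -> 0 < rho -> (forall v, 0 <= r v 0%N) ->
  let K := \prod_(m <= v < (n.+1 * m).+1) r v 0%N in
  let L := ((n.+1 * m).+1 - m)%N in
  K * cut_weight n lam (fun=> ratio p) m s <= rho ^+ L * cut_weight n lam r m s /\
  cut_weight n lam r m s <= rho ^+ L * (K * cut_weight n lam (fun=> ratio p) m s).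
Proof.
move=> H p1 p2 r0 rv0 K L.
have sp v : (parent_spin n s v <= 2)%N by case: v => //= v; rewrite -ltnS.
have h0 := @heap_weight_ge0 R n lam l0 m s.
have rat0 j : 0 <= ratio p j by case: j => [|[|j]] //=; [exact: ltW|rewrite mulr_ge0 // ltW].
have e1 : rho ^+ L = \prod_(m <= v < (n.+1 * m).+1) rho by rewrite prodr_const_nat.
have e2 : K * \prod_(m <= v < (n.+1 * m).+1) ratio p (parent_spin n s v) =
    \prod_(m <= v < (n.+1 * m).+1) (r v 0%N * ratio p (parent_spin n s v)).
  by rewrite big_split.
rewrite /cut_weight; split.
  rewrite mulrCA e2 [leRHS]mulrCA ler_wpM2l // e1 -big_split /=.
  rewrite !big_nat; apply: ler_prod => v /andP[mv vm].
  have mvv : (m <= v <= n.+1 * m)%N by rewrite mv.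
  by have [_ -> _] := H v _ mvv (sp v); rewrite mulr_ge0.
rewrite (mulrCA K) e2 [leRHS]mulrCA ler_wpM2l // e1 -big_split /=.
rewrite !big_nat; apply: ler_prod => v /andP[mv vm].
have mvv : (m <= v <= n.+1 * m)%N by rewrite mv.
by have [-> _ ->] := H v _ mvv (sp v).
Qed.

End MessageSandwich.

(** * Marginals compatible with the Gibbs property *)
Definition glue (m : nat) (s t : nat -> 'I_3) : nat -> 'I_3 :=
  fun i => if (i < m)%N then s i else t i.

Lemma sumc_glue (R : realType) k m M (F : (nat -> 'I_3) -> R) s t : (m <= M)%N ->
  sumc k M F (glue m s t) = sumc k M (fun u => F (glue m s u)) t.
Proof.
elim: k M t => [//|k IH] M t mM /=; apply: eq_bigr => a _.
rewrite -IH ?(leq_trans mM) //; congr (sumc _ _ _ _); apply/funext => i.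
by rewrite /upd /glue; case: eqP => // ->; rewrite ltnNge mM.
Qed.

Section Marginals.
Variables (R : realType) (n : nat) (lam : R).
Hypothesis l0 : 0 < lam.

Variable p : R * R.
Hypotheses (p1 : 0 < p.1) (p2 : 0 < p.2) (pfix : msg_map n lam p = p).
Hypothesis plim : forall rho, 1 < rho -> exists k,
     [/\ p.1 <= rho * (msg_bounds n lam k).1.1, p.2 <= rho * (msg_bounds n lam k).1.2,
         (msg_bounds n lam k).2.1 <= rho * p.1 & (msg_bounds n lam k).2.2 <= rho * p.2].

Let Phi := cut_weight n lam (fun=> ratio p).

Section Compare.
Variable N : nat -> (nat -> 'I_3) -> R.
Hypothesis Nge0 : forall m s, 0 <= N m s.
Hypothesis Nsum : forall m s, N m s = \sum_(a : 'I_3) N m.+1 (upd s m a).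
Hypothesis Next : forall m s t, (forall i, (i < m)%N -> s i = t i) -> N m s = N m t.
Hypothesis Ndlr : forall M s t, (forall i, (M <= i <= n.+1 * M)%N -> s i = t i) ->
  N (n.+1 * M).+1 s * cut_weight n lam (msg n lam s M 0) M t =
  N (n.+1 * M).+1 t * cut_weight n lam (msg n lam s M 0) M s.

Lemma N_sumc k m s : N m s = sumc k m (N (m + k)) s.
Proof.
elim: k m s => [|k IH] m s; first by rewrite addn0.
by rewrite Nsum /= -addSnnS; apply: eq_bigr => a _; rewrite IH.
Qed.

(** The ratio identity [Ndlr] is bilinear in two configurations that agree
    beyond M, so it survives summing each of them over m, ..., M-1; on the
    explicit side this produces messages. *)
Lemma dlr_sumc M m s t : (m <= M)%N -> (forall i, (m <= i)%N -> s i = t i) ->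
  sumc (M - m) m (N (n.+1 * M).+1) s * cut_weight n lam (msg n lam s M (M - m)) m t =
  sumc (M - m) m (N (n.+1 * M).+1) t * cut_weight n lam (msg n lam s M (M - m)) m s.
Proof.
move=> mM st; have e : (M - (M - m))%N = m by rewrite subKn.
have K (z : nat -> 'I_3) : cut_weight n lam (msg n lam s M (M - m)) m z =
    sumc (M - m) m (cut_weight n lam (msg n lam s M 0) M) z.
  by have := @sumc_msg R n lam s M (M - m) z (leq_subr _ _); rewrite e.
rewrite !K.
have A t' : (forall i, (M <= i)%N -> t' i = s i) ->
    sumc (M - m) m (N (n.+1 * M).+1) s * cut_weight n lam (msg n lam s M 0) M t' =
    N (n.+1 * M).+1 t' * sumc (M - m) m (cut_weight n lam (msg n lam s M 0) M) s.
  move=> t's; rewrite mulrC -!sumcZ; apply: eq_sumc => s' _ h.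
  rewrite mulrC.
  have ss i : (M <= i)%N -> s i = s' i by move=> Mi; rewrite h // subnKC.
  have := @Ndlr M s' t'.
  have -> : cut_weight n lam (msg n lam s' M 0) M t' = cut_weight n lam (msg n lam s M 0) M t'.
    by apply: cut_weight_ext => // v j /andP[Mv _] /=; rewrite ss.
  have -> : cut_weight n lam (msg n lam s' M 0) M s' = cut_weight n lam (msg n lam s M 0) M s'.
    by apply: cut_weight_ext => // v j /andP[Mv _] /=; rewrite ss.
  by apply=> i /andP[Mi _]; rewrite -ss // t's.
rewrite [RHS]mulrC -!sumcZ; apply: eq_sumc => t' _ h.
rewrite mulrC [RHS]mulrC -A 1?mulrC // => i Mi.
by rewrite h ?subnKC // st // (leq_trans mM).
Qed.

(** For M large, all messages at the cut of the first m vertices are within a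
    factor rho^2 of the fixed point, uniformly in the configuration beyond M.
    Averaging over that configuration and letting rho tend to 1 gives one
    inequality; exchanging s and t gives the other. *)
Lemma marginal_ratio m s t : N m s * Phi m t = N m t * Phi m s.
Proof.
suff le s' t' : N m s' * Phi m t' <= N m t' * Phi m s'.
  by apply/eqP; rewrite eq_le !le.
move=> {s t}; move: s' t' => s t.
set L := ((n.+1 * m).+1 - m)%N.
apply: (@le_expr_limit _ _ _ (2 * (L + L))) => rho r1.
have r0 : 0 < rho ^+ 2 by rewrite exprn_gt0 //; lra.
have [k [k1 k2 k3 k4]] := plim r1.
pose M := maxn m (reach n k (n.+1 * m)).
have mM : (m <= M)%N by rewrite leq_maxl.
have key s' t' : (forall i, (m <= i)%N -> s' i = t' i) ->
  sumc (M - m) m (N (n.+1 * M).+1) s' * Phi m t' <=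
  (rho ^+ 2) ^+ (L + L) * (sumc (M - m) m (N (n.+1 * M).+1) t' * Phi m s').
  move=> st; have := dlr_sumc mM st.
  set S := msg n lam s' M (M - m).
  have inb v : (m <= v <= n.+1 * m)%N -> in_bounds (msg_bounds n lam k) (S v).
    move=> /andP[mv vm]; apply: msg_in_bounds => //; [exact: leq_subr|by rewrite subKn|move=> _].
    by apply: leq_trans (leq_maxr _ _); exact: reach_mono.
  have S0 v : 0 <= S v 0%N.
    have [mv|vm] := leqP m v.
      have [] : in_bounds (msg_bounds n lam 0) (S v); last by move=> /ltW.
      by apply: msg_in_bounds => //; [exact: leq_subr|rewrite subKn].
    have e d : (d <= M - m)%N -> msg n lam s' M d v = msg n lam s' M 0 v.
      elim: d => [//|d IH] dM /=; rewrite ltn_eqF; last by lia.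
      by apply: IH; exact: ltnW.
    by rewrite /S e //= ler0n.
  have [l00 _ _ _ _] := msg_bounds_inv n l0 k.
  have cl v j : (m <= v <= n.+1 * m)%N -> (j <= 2)%N -> [/\ 0 <= S v j,
      S v 0%N * ratio p j <= rho ^+ 2 * S v j & S v j <= rho ^+ 2 * (S v 0%N * ratio p j)].
    by move=> mv j2; apply: in_bounds_ratio (inb _ mv) j2.
  have [_ hs] := cut_weight_sandwich l0 s' cl p1 p2 r0 S0.
  have [ht _] := cut_weight_sandwich l0 t' cl p1 p2 r0 S0.
  move: hs ht; rewrite -/L -/Phi; set K := \prod_(_ <= _ < _) _ => hs ht E.
  have K0 : 0 < K.
    rewrite /K big_nat; apply: prodr_gt0 => v /andP[mv vm].
    by have [] : in_bounds (msg_bounds n lam k) (S v) by apply: inb; rewrite mv.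
  have A0 z : 0 <= sumc (M - m) m (N (n.+1 * M).+1) z.
    have -> : 0 = sumc (M - m) m (fun=> 0 * 0 : R) z by rewrite sumcZ mul0r.
    by apply: sumc_le => u _ _; rewrite mul0r.
  rewrite -(ler_pM2l K0) mulrCA.
  apply: le_trans (ler_wpM2l (A0 _) ht) _.
  rewrite mulrCA E mulrCA.
  apply: le_trans (ler_wpM2l (A0 _) (ler_wpM2l (exprn_ge0 _ (ltW r0)) hs)) _.
  by rewrite le_eqVlt exprD; apply/orP; left; apply/eqP; ring.
have PE z z' : Phi m (glue m z z') = Phi m z.
  by apply: cut_weight_ext => // i im; rewrite /glue im.
have NE z : N m z = sumc ((n.+1 * M).+1 - M) M
    (fun u => sumc (M - m) m (N (n.+1 * M).+1) (glue m z u)) s.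
  rewrite (@Next m z (glue m z s)); last by move=> i im; rewrite /glue im.
  rewrite (N_sumc ((M - m) + ((n.+1 * M).+1 - M))).
  have -> : (m + (M - m + ((n.+1 * M).+1 - M)))%N = (n.+1 * M).+1 by nia.
  by rewrite sumcD sumc_comm ?subnKC // sumc_glue.
rewrite (NE s) (NE t) mulrC [_ * Phi m s]mulrC -!sumcZ exprM.
apply: sumc_le => u _ _; rewrite mulrC -(PE t u).
apply: le_trans (key _ _ _) _; first by move=> i mi; rewrite /glue ltnNge mi.
by rewrite PE [Phi m s * _]mulrC.
Qed.

End Compare.

(** A fixed point of the ratios is a message reproduced up to a scalar C. *)
Lemma parent_fix_const : exists2 C : R, 0 < C &
  forall m j, (j <= 2)%N -> msg_rec n lam (fun=> ratio p) m j = C * ratio p j.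
Proof.
have E m j : (j <= 2)%N -> msg_rec n lam (fun=> ratio p) m j =
    1 + (if (j <= 1)%N then lam * p.1 ^+ n.+1 else 0) +
    (if j == 0%N then lam ^+ 2 * (p.1 * p.2) ^+ n.+1 else 0).
  move=> j2; rewrite /msg_rec sum_compatible_spins // !inordK //= expr0 expr1 mul1r.
  by rewrite !prodr_const card_ord expr1n.
have h0 : 0 < lam * p.1 ^+ n.+1 by rewrite mulr_gt0 // exprn_gt0.
have h1 : 0 < lam * p.2 ^+ n.+1 by rewrite mulr_gt0 // exprn_gt0.
have := congr1 fst pfix; have := congr1 snd pfix; rewrite /= /hc_map.
set A := lam * _ in h0 E *; set B := lam * _ in h1 *; move=> e2 e1.
exists (1 + A + lam ^+ 2 * (p.1 * p.2) ^+ n.+1).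
  by rewrite !addr_gt0 // mulr_gt0 ?exprn_gt0 // mulr_gt0.
have AB : lam ^+ 2 * (p.1 * p.2) ^+ n.+1 = A * B by rewrite /A /B exprMn; ring.
have A1 : 1 + A != 0 by rewrite gt_eqF //; lra.
have e1' : p.1 * (1 + A + A * B) = 1 + A.
  have -> : p.1 * (1 + A + A * B) = p.1 * (1 + B * (1 - (1 + A)^-1)) * (1 + A) by field.
  rewrite -e1 mulVf ?mul1r // gt_eqF // ltr_pwDl //.
  by apply: mulr_ge0; [exact: ltW|rewrite subr_ge0 invf_le1; lra].
have e2' : p.2 * (1 + A) = 1 by rewrite -e2 mulVf.
move=> m [|[|[|//]]] _; rewrite E //= ?addr0 AB ?mulr1 //.
  by rewrite mulrC e1'.
by rewrite mulrA [_ * p.1]mulrC e1' mulrC e2'.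
Qed.

End Marginals.

(** * The finite-volume specification *)
Section LocalSpec.
Variables (V : choiceType) (C : nat) (adj : rel V) (R : realType) (lam : R).
Hypothesis l0 : 0 < lam.
Hypothesis adj_sym : symmetric adj.
Hypothesis in_bdryP : forall (U : {fset V}) x,
  x \in bdry adj U <-> x \notin U /\ exists2 z, z \in U & adj x z.
Implicit Types (U W : {fset V}) (t : config V C).

Definition override U (eta : {ffun U -> 'I_C.+1}) t : config V C :=
  fun x => if insub x is Some u then eta u else t x.

Lemma override_in U (eta : {ffun U -> 'I_C.+1}) t (u : U) :
  override eta t (val u) = eta u.
Proof. by rewrite /override valK. Qed.

Lemma override_out U (eta : {ffun U -> 'I_C.+1}) t x : x \notin U -> override eta t x = t x.
Proof. by move=> xU; rewrite /override insubN. Qed.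

Lemma override_restr U t t' : (forall x, x \notin U -> t x = t' x) ->
  override (restr U t) t' = t.
Proof.
move=> h; apply/funext => x; have [xU|xU] := boolP (x \in U).
  by rewrite -[x]/(val [` xU]%fset) override_in ffunE.
by rewrite override_out // h.
Qed.

Definition loc_ok U t := forall x y, x \in U -> adj x y -> (t x + t y <= C)%N.

(** The part of the Gibbs weight that involves the spins in U; whatever else
    enters the weight of the closed neighbourhood cancels in the conditional
    probability. *)
Definition loc_weight U t : R :=
  \prod_(x <- U) lam ^+ t x * `[< loc_ok U t >]%:R.

(** Two boundary vertices of U may be adjacent, so a boundary condition can be
    contradictory by itself. *)
Definition bdry_ok U t :=
  forall x y, x \in bdry adj U -> y \in bdry adj U -> adj x y -> (t x + t y <= C)%N.

Lemma loc_weight_ge0 U t : 0 <= loc_weight U t.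
Proof.
by rewrite mulr_ge0 ?ler0n // prodr_ge0 // => x _; rewrite exprn_ge0 // ltW.
Qed.

Lemma loc_partition_gt0 U t : 0 < \sum_(eta : {ffun U -> 'I_C.+1}) loc_weight U (override eta t).
Proof.
rewrite (bigD1 [ffun=> ord0]) //= ltr_pwDl ?sumr_ge0 // => [|eta _]; last exact: loc_weight_ge0.
rewrite /loc_weight mulr_gt0 ?prodr_gt0 // => [x _|]; first by rewrite exprn_gt0.
rewrite asboolT ?ltr01 // => x y xU _.
have -> : override ([ffun=> ord0] : {ffun U -> 'I_C.+1}) t x = ord0.
  by rewrite -[x]/(val [` xU]%fset) override_in ffunE.
by rewrite add0n -ltnS.
Qed.

Let W U := closed_nbhd adj U.

Let inW U x : (x \in W U) = (x \in U) || (x \in bdry adj U).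
Proof. by rewrite /W /closed_nbhd in_fsetU. Qed.

Let ext U (eta : {ffun U -> 'I_C.+1}) t : {ffun W U -> 'I_C.+1} := restr (W U) (override eta t).

Let extE U (eta : {ffun U -> 'I_C.+1}) t (x : W U) : ext eta t x = override eta t (val x).
Proof. by rewrite ffunE. Qed.

Let bdryN U x : x \in bdry adj U -> x \notin U.
Proof. by case/in_bdryP. Qed.

Let adjW U x y : x \in U -> adj x y -> y \in W U.
Proof.
move=> xU xy; rewrite inW; have [//|yU] := boolP (y \in U).
by apply/orP; right; apply/in_bdryP; split => //; exists x => //; rewrite adj_sym.
Qed.

(** A configuration on the closure of U with prescribed boundary is the same as
    a configuration on U. *)
Lemma sum_agree_bdry U t (F : {ffun W U -> 'I_C.+1} -> R) (P : pred {ffun W U -> 'I_C.+1}) :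
  \sum_(s | P s && agree (bdry adj U) s t) F s =
  \sum_(eta : {ffun U -> 'I_C.+1} | P (ext eta t)) F (ext eta t).
Proof.
pose h (s : {ffun W U -> 'I_C.+1}) : {ffun U -> 'I_C.+1} := restr U (override s (fun=> ord0)).
rewrite (reindex_onto (fun eta => ext eta t) h) /=; last first.
  move=> s /andP[_ /forallP ag]; apply/ffunP => x; rewrite extE.
  have [xU|xU] := boolP (val x \in U).
    by rewrite -[val x]/(val [` xU]%fset) override_in ffunE /= override_in.
  rewrite override_out //; have := ag x; have := valP x; rewrite inW (negbTE xU) /= => -> /=.
  by move=> /eqP.
apply: eq_bigl => eta.
have -> : agree (bdry adj U) (ext eta t) t.
  by apply/forallP => x; apply/implyP => xb; rewrite extE override_out ?bdryN.
have -> : h (ext eta t) == eta.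
  apply/eqP/ffunP => u; rewrite ffunE.
  have uW : val u \in W U by rewrite inW (valP u).
  by rewrite -[val u]/(val [` uW]%fset) override_in extE /= override_in.
by rewrite !andbT.
Qed.

Lemma ext_allowable U t (eta : {ffun U -> 'I_C.+1}) : bdry_ok U t ->
  allowable (@Defs.induced V adj (W U)) (ext eta t) <-> loc_ok U (override eta t).
Proof.
move=> bok; split=> [al x y xU xy|lo x y xy].
  have yW := adjW xU xy; have xW : x \in W U by rewrite inW xU.
  by have := al [` xW]%fset [` yW]%fset xy; rewrite !extE.
rewrite !extE; have [xU|xU] := boolP (val x \in U); first exact: lo xU xy.
have [yU|yU] := boolP (val y \in U).
  by rewrite addnC; apply: lo yU _; rewrite adj_sym.
rewrite !override_out //; have := valP x; have := valP y.
by rewrite !inW (negbTE xU) (negbTE yU) /= => ? ?; apply: bok.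
Qed.

Lemma ext_weight U t (eta : {ffun U -> 'I_C.+1}) :
  hc_weight lam (ext eta t) =
  (\prod_(x <- U) lam ^+ override eta t x) * \prod_(x <- bdry adj U) lam ^+ t x.
Proof.
rewrite /hc_weight; under eq_bigr do rewrite extE.
rewrite -(big_seq_fsetE _ _ predT (fun x => lam ^+ override eta t x)) /=.
rewrite -[RHS](_ : \prod_(x <- U) lam ^+ override eta t x *
  \prod_(x <- bdry adj U) lam ^+ override eta t x = _); last first.
  by congr (_ * _); apply: eq_big_seq => x xb; rewrite override_out ?bdryN.
rewrite -big_cat; apply: perm_big; apply: uniq_perm; first exact: fset_uniq.
  rewrite cat_uniq !fset_uniq /= andbT; apply/hasPn => x; exact: bdryN.
by move=> x; rewrite mem_cat -inW.
Qed.

Lemma hc_partition_gt0 U : 0 < hc_partition C (@Defs.induced V adj U) lam.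
Proof.
rewrite /hc_partition (bigD1 [ffun=> ord0]) /=; last first.
  by apply/asboolP => x y _; rewrite !ffunE.
rewrite ltr_pwDl ?sumr_ge0 // => [|s _].
  by apply: prodr_gt0 => v _; rewrite exprn_gt0.
by apply: prodr_ge0 => v _; rewrite exprn_ge0 // ltW.
Qed.

Lemma local_specE U t : local_spec adj lam U t =
  (\sum_(s : {ffun W U -> 'I_C.+1} | (`[< allowable (@Defs.induced V adj (W U)) s >] && agree U s t) && agree (bdry adj U) s t)
     hc_weight lam s) /
  (\sum_(s : {ffun W U -> 'I_C.+1} | `[< allowable (@Defs.induced V adj (W U)) s >] && agree (bdry adj U) s t)
     hc_weight lam s).
Proof.
rewrite /local_spec /hc_cond /hc_measure.
have Z0 := hc_partition_gt0 (W U).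
rewrite invf_div mulrA divfK ?gt_eqF //; congr (_ / _).
by apply: eq_bigl => s; rewrite /= andbA.
Qed.

(** The conditioning event is then empty, and the quotient by zero is zero. *)
Lemma local_spec_conflict U t : ~ bdry_ok U t -> local_spec adj lam U t = 0.
Proof.
move=> nb; rewrite local_specE [X in _ / X]big1 ?invr0 ?mulr0 // => s.
case/andP=> /asboolP al /forallP ag; exfalso; apply: nb => x y xb yb xy.
have xW : x \in W U by rewrite inW xb orbT.
have yW : y \in W U by rewrite inW yb orbT.
have := al [` xW]%fset [` yW]%fset xy.
by have /implyP/(_ xb)/eqP -> := ag [` xW]%fset; have /implyP/(_ yb)/eqP -> := ag [` yW]%fset.
Qed.

Lemma local_spec_ok U t : bdry_ok U t ->
  local_spec adj lam U t =
  loc_weight U t / \sum_(eta : {ffun U -> 'I_C.+1}) loc_weight U (override eta t).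
Proof.
move=> bok; rewrite local_specE !sum_agree_bdry.
pose B := \prod_(x <- bdry adj U) lam ^+ t x.
have B0 : 0 < B by apply: prodr_gt0 => x _; rewrite exprn_gt0.
have wE eta : (if `[< allowable (@Defs.induced V adj (W U)) (ext eta t) >] then hc_weight lam (ext eta t)
   else 0) = loc_weight U (override eta t) * B.
  rewrite (asbool_equiv_eq (ext_allowable _ bok)) ext_weight /loc_weight -/B.
  by case: ifP => _; rewrite ?mulr1 // mulr0 mul0r.
have agE (eta : {ffun U -> 'I_C.+1}) : agree U (ext eta t) t = (eta == restr U t).
  apply/forallP/eqP => [ag|-> x]; last by apply/implyP => xU; rewrite extE override_restr.
  apply/ffunP => u; have uW : val u \in W U by rewrite inW (valP u).
  have /implyP/(_ (valP u))/eqP := ag [` uW]%fset.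
  by rewrite extE /= override_in ffunE.
rewrite [X in _ / X]big_mkcond /=; under [X in _ / X]eq_bigr do rewrite wE.
rewrite -mulr_suml big_mkcondl /=; under eq_bigr do rewrite wE.
rewrite (eq_bigl (pred1 (restr U t))) => [|eta]; last by rewrite agE.
rewrite big_pred1_eq override_restr //.
by rewrite -mulf_div divff ?mulr1 // gt_eqF.
Qed.

Lemma local_spec_ge0 U t : 0 <= local_spec adj lam U t.
Proof.
have [/asboolP ok|/asboolP ok] := boolP `[< bdry_ok U t >]; last by rewrite local_spec_conflict.
by rewrite local_spec_ok // divr_ge0 ?loc_weight_ge0 // ltW // loc_partition_gt0.
Qed.

End LocalSpec.

(** * Heap numbering of the tree *)
Section HeapNumbering.
Variable n : nat.
Notation V := (seq 'I_n.+1).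
Implicit Types (x y : V) (U : {fset V}).

Fixpoint code x : nat := if x is i :: x' then (n.+1 * code x' + i).+1 else 0%N.

Fixpoint decode_fuel (f k : nat) : V :=
  if f is f'.+1 then
    if k is k'.+1 then inord (k' %% n.+1)%N :: decode_fuel f' (k' %/ n.+1)%N else [::]
  else [::].

Definition decode k := decode_fuel k k.

Lemma decodeK : cancel decode code.
Proof.
suff H f k : (k <= f)%N -> code (decode_fuel f k) = k by move=> k; exact: H.
elim: f k => [|f IH] [|k] //= kf.
rewrite IH; last by rewrite (leq_trans (leq_div _ _)).
by rewrite inordK ?ltn_pmod // mulnC -divn_eq.
Qed.

Lemma code_inj : injective code.
Proof.
elim=> [|i x IH] [|j y] //= [E].
have ij : i = j :> nat.
  have := congr1 (modn^~ n.+1) E.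
  by rewrite /= !(mulnC n.+1) !modnMDl !modn_small.
have xy : code x = code y.
  by move: E; rewrite ij => /addIn/eqP; rewrite eqn_mul2l => /eqP.
by rewrite (IH _ xy) (ord_inj ij).
Qed.

Lemma codeK : cancel code decode.
Proof. by move=> x; apply: code_inj; rewrite decodeK. Qed.

Definition heap_parent (v : nat) : nat := (v.-1 %/ n.+1)%N.

Lemma code_cons i x : (0 < code (i :: x))%N /\ heap_parent (code (i :: x)) = code x.
Proof. by rewrite /heap_parent /= mulnC divnMDl // divn_small // addn0. Qed.

Lemma decode_cons v : (0 < v)%N -> exists i, decode v = i :: decode (heap_parent v).
Proof.
case: v => [//|v] _; exists (inord (v %% n.+1)).
apply: code_inj; rewrite decodeK /= decodeK inordK ?ltn_pmod //.
by rewrite /heap_parent /= mulnC -divn_eq.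
Qed.

Lemma tree_adjP x y : reflect
  ((0 < code y)%N /\ code x = heap_parent (code y) \/ (0 < code x)%N /\ code y = heap_parent (code x))
  (tree_adj x y).
Proof.
apply: (iffP orP) => [[/existsP[i /eqP ->]|/existsP[i /eqP ->]]|[[y0 xy]|[x0 yx]]].
- by left; have [? ->] := code_cons i x.
- by right; have [? ->] := code_cons i y.
- left; apply/existsP; have [i] := decode_cons y0.
  by rewrite -xy !codeK => ->; exists i.
- right; apply/existsP; have [i] := decode_cons x0.
  by rewrite -yx !codeK => ->; exists i.
Qed.

Lemma tree_adj_sym : symmetric (@tree_adj n.+1).
Proof. by move=> x y; rewrite /tree_adj orbC. Qed.

Definition heapify (t : V -> 'I_3) : nat -> 'I_3 := t \o decode.

Lemma parent_spinE s v : (0 < v)%N -> parent_spin n s v = s (heap_parent v).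
Proof. by case: v. Qed.

Lemma allowable_heap (t : V -> 'I_3) :
  allowable (@tree_adj n.+1) t <-> forall v, edge_ok n (heapify t) v.
Proof.
split=> [al v|ok x y /tree_adjP[[y0 xy]|[x0 yx]]].
- have [->|v0] := posnP v; first by rewrite /edge_ok /= addn0 -ltnS.
  rewrite /edge_ok parent_spinE // /heapify /=; apply: al; apply/tree_adjP.
  by right; rewrite !decodeK.
- have := ok (code y); rewrite /edge_ok parent_spinE // /heapify /= -xy !codeK.
  by rewrite addnC.
- by have := ok (code x); rewrite /edge_ok parent_spinE // /heapify /= -yx !codeK.
Qed.

(** The edge from v to its parent, virtual for the root, has an end in U. *)
Definition touches U (v : nat) : bool :=
  (decode v \in U) || ((0 < v)%N && (decode (heap_parent v) \in U)).

Lemma loc_ok_heap U (t : config V 2) N : (forall v, touches U v -> (v < N)%N) ->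
  loc_ok (@tree_adj n.+1) U t <->
  (forall v, (v < N)%N -> touches U v -> edge_ok n (heapify t) v).
Proof.
move=> hN; split=> [lo v _ /orP[vU|/andP[v0 pU]]|ok x y xU].
- have [->|v0] := posnP v; first by rewrite /edge_ok /= addn0 -ltnS.
  rewrite /edge_ok parent_spinE // /heapify /=; apply: lo => //; apply/tree_adjP.
  by right; rewrite !decodeK.
- rewrite /edge_ok parent_spinE // /heapify /= addnC; apply: lo => //; apply/tree_adjP.
  by left; rewrite !decodeK.
- case/tree_adjP=> -[y0 xy].
    have ty : touches U (code y) by rewrite /touches y0 -xy !codeK xU orbT.
    have := ok _ (hN _ ty) ty; rewrite /edge_ok parent_spinE // /heapify /= -xy !codeK.
    by rewrite addnC.
  have tx : touches U (code x) by rewrite /touches codeK xU.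
  by have := ok _ (hN _ tx) tx; rewrite /edge_ok parent_spinE // /heapify /= -xy !codeK.
Qed.

Lemma prod_natr_bool (R : realType) (P Q : pred nat) N :
  \prod_(0 <= v < N | P v) (Q v)%:R = (all Q [seq v <- iota 0 N | P v])%:R :> R.
Proof.
rewrite -big_filter /index_iota subn0.
elim: [seq v <- _ | _] => [|v l IH]; first by rewrite big_nil.
by rewrite big_cons IH -natrM mulnb.
Qed.

Lemma loc_weight_heap (R : realType) (lam : R) U (t : config V 2) M N :
  (forall x, x \in U -> (code x < M)%N) -> (forall v, touches U v -> (v < N)%N) ->
  loc_weight (@tree_adj n.+1) lam U t =
  \prod_(0 <= v < M | decode v \in U) lam ^+ heapify t v *
  \prod_(0 <= v < N | touches U v) (edge_ok n (heapify t) v)%:R.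
Proof.
move=> hM hN; rewrite /loc_weight prod_natr_bool; congr (_ * _%:R).
  rewrite -[RHS]big_filter -(big_map decode predT (fun x => lam ^+ t x)).
  apply: perm_big; apply: uniq_perm; first exact: fset_uniq.
    by rewrite (map_inj_uniq (can_inj decodeK)) filter_uniq // iota_uniq.
  move=> x; apply/idP/mapP => [xU|[v]].
    by exists (code x); rewrite ?codeK // mem_filter codeK xU mem_index_iota hM.
  by rewrite mem_filter => /andP[vU _] ->.
congr (nat_of_bool _); apply/asboolP/allP => [/(loc_ok_heap _ hN) lo v|h].
  by rewrite mem_filter mem_iota add0n => /andP[tv /andP[_ vN]]; exact: lo.
apply/(loc_ok_heap _ hN) => v vN tv; apply: h.
by rewrite mem_filter tv mem_iota.
Qed.

Definition heap_prefix (N : nat) : {fset V} := [fset decode i | i in iota 0 N]%fset.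

Lemma in_heap_prefix N x : (x \in heap_prefix N) = (code x < N)%N.
Proof.
apply/imfsetP/idP => [[i /= iN ->]|xN]; first by rewrite decodeK; rewrite mem_iota in iN.
by exists (code x); rewrite ?codeK //= mem_iota.
Qed.

Lemma in_bdry_prefix N x : (0 < N)%N ->
  (x \in bdry (@tree_adj n.+1) (heap_prefix N)) = (N <= code x <= n.+1 * N)%N.
Proof.
move=> N0; apply/idP/idP.
  case/in_bdry_tree; rewrite in_heap_prefix -leqNgt => Nx [z]; rewrite in_heap_prefix => zN.
  rewrite Nx /= => /tree_adjP[[z0 xz]|[x0 zx]].
    by move: Nx; rewrite xz /heap_parent leqNgt (leq_ltn_trans (leq_div _ _)) //; lia.
  move: zN; rewrite zx /heap_parent ltn_divLR // => h.
  by rewrite mulnC; lia.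
move=> /andP[Nx xN]; apply/in_bdry_tree; rewrite in_heap_prefix -leqNgt Nx; split => //.
have x0 : (0 < code x)%N by lia.
exists (decode (heap_parent (code x))).
  by rewrite in_heap_prefix decodeK /heap_parent ltn_divLR //; nia.
by apply/tree_adjP; right; rewrite decodeK.
Qed.

Lemma loc_weight_prefix (R : realType) (lam : R) N (t : config V 2) (s : nat -> 'I_3) :
  (0 < N)%N -> (forall i, (N <= i <= n.+1 * N)%N -> s i = heapify t i) ->
  loc_weight (@tree_adj n.+1) lam (heap_prefix N) t =
  cut_weight n lam (msg n lam s N 0) N (heapify t).
Proof.
move=> N0 st.
have tch v : touches (heap_prefix N) v = (v < (n.+1 * N).+1)%N.
  rewrite /touches !in_heap_prefix !decodeK.
  have [->|v0] := posnP v; first by rewrite N0.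
  rewrite /heap_parent ltn_divLR // mulnC.
  by apply/orP/idP => [[|]|]; [nia|lia|right; lia].
rewrite (@loc_weight_heap _ _ _ _ N (n.+1 * N).+1); last 2 first.
- by move=> x; rewrite in_heap_prefix.
- by move=> v; rewrite tch.
rewrite /cut_weight /heap_weight big_split /= -mulrA.
rewrite (@big_nat_cond _ _ _ 0 N (fun v => _ \in _)).
rewrite (eq_bigl (fun i => (0 <= i < N)%N && true)) => [|i]; last first.
  by rewrite andbT in_heap_prefix decodeK; case: ltnP => //; rewrite ?andbF.
rewrite -big_nat_cond; congr (_ * _).
rewrite big_nat_cond (eq_bigl (fun i => (0 <= i < (n.+1 * N).+1)%N && true)) => [|i]; last first.
  by rewrite andbT tch andbb.
rewrite -big_nat_cond (@big_cat_nat _ _ _ N) //=; last by nia.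
by congr (_ * _); apply: eq_big_nat => i iN; rewrite /edge_ok st.
Qed.

(** The Gibbs property of weights in ratio form: the factors of [cut_weight]
    that involve U are those of [loc_weight], and the other ones agree for t
    and t'. *)
Lemma cut_weight_local (R : realType) (lam : R) r U (t t' : config V 2) M :
  (forall v, touches U v -> (v < M)%N) -> (forall x, x \notin U -> t x = t' x) ->
  cut_weight n lam r M (heapify t) * loc_weight (@tree_adj n.+1) lam U t' =
  cut_weight n lam r M (heapify t') * loc_weight (@tree_adj n.+1) lam U t.
Proof.
move=> hM tt.
have hU x : x \in U -> (code x < M)%N.
  by move=> xU; apply: hM; rewrite /touches codeK xU.
rewrite !(@loc_weight_heap _ _ _ _ M M) //.
pose rest (z : config V 2) := \prod_(0 <= v < M | decode v \notin U) lam ^+ heapify z v *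
  \prod_(0 <= v < M | ~~ touches U v) (edge_ok n (heapify z) v)%:R *
  \prod_(M <= v < (n.+1 * M).+1) r v (parent_spin n (heapify z) v).
have E z : cut_weight n lam r M (heapify z) =
   \prod_(0 <= v < M | decode v \in U) lam ^+ heapify z v *
   \prod_(0 <= v < M | touches U v) (edge_ok n (heapify z) v)%:R * rest z.
  rewrite /cut_weight /heap_weight big_split /=.
  have -> : \prod_(0 <= v < M) (edge_ok n (heapify z) v)%:R =
      \prod_(0 <= v < M | touches U v) (edge_ok n (heapify z) v)%:R *
      \prod_(0 <= v < M | ~~ touches U v) (edge_ok n (heapify z) v)%:R :> R.
    by rewrite (bigID (touches U)).
  rewrite (bigID (fun v => decode v \in U)) /= /rest.
  by ring.
rewrite !E; have -> : rest t = rest t'; last by ring.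
have hp v : decode v \notin U -> heapify t v = heapify t' v by move=> vU; rewrite /heapify /= tt.
have sp v : ~~ ((0 < v)%N && (decode (heap_parent v) \in U)) ->
    parent_spin n (heapify t) v = parent_spin n (heapify t') v.
  by have [->//|v0] := posnP v => /= vU; rewrite !parent_spinE // hp.
congr (_ * _ * _).
- by apply: eq_bigr => v vU; rewrite hp.
- by apply: eq_bigr => v; rewrite negb_or => /andP[v1 v2]; rewrite /edge_ok hp // sp.
- apply: eq_big_nat => v /andP[Mv _]; rewrite sp //; apply/negP => h.
  by have := hM v; rewrite /touches h orbT => /(_ isT); rewrite ltnNge Mv.
Qed.

End HeapNumbering.

(** * Cylinders over initial segments *)
Section PrefixCylinders.
Variable n : nat.
Notation V := (seq 'I_n.+1).
Notation T := (config V 2).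
Implicit Types (W : set V) (s : nat -> 'I_3).
Local Open Scope classical_set_scope.

(** Only the coordinates in W are constrained; W is the whole tree for the masses
    and the complement of a finite set for conditioning. *)
Definition prefix_cyl W m s : set T :=
  [set t | forall i, (i < m)%N -> W (decode n i) -> heapify t i = s i].

Lemma prefix_cyl0 W s : prefix_cyl W 0 s = setT.
Proof. by apply/seteqP; split. Qed.

Lemma prefix_cyl_ext W m s s' : (forall i, (i < m)%N -> s i = s' i) ->
  prefix_cyl W m s = prefix_cyl W m s'.
Proof.
by move=> e; apply/seteqP; split => t h i im Wi; rewrite h // e.
Qed.

Lemma prefix_cylS_out W m s : ~ W (decode n m) -> prefix_cyl W m.+1 s = prefix_cyl W m s.
Proof.
move=> Wm; apply/seteqP; split => t h i im Wi; first by apply: h => //; exact: ltnW.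
rewrite ltnS leq_eqVlt in im; case/orP: im => [/eqP e|]; last by move=> /h; exact.
by rewrite e in Wi.
Qed.

Lemma prefix_cylS_in W m s : W (decode n m) ->
  prefix_cyl W m.+1 s = prefix_cyl W m s `&` [set t | t (decode n m) = s m].
Proof.
move=> Wm; apply/seteqP; split => [t h|t [h1 h2] i].
  by split => [i im Wi|]; apply: h => //; exact: ltnW.
by rewrite ltnS leq_eqVlt => /orP[/eqP -> _|im Wi]; [exact: h2|exact: h1].
Qed.

Lemma prefix_cyl_bigU W m s : W (decode n m) ->
  prefix_cyl W m s = \big[setU/set0]_(a < 3) prefix_cyl W m.+1 (upd s m a).
Proof.
move=> Wm; rewrite -(@bigcup_mkord_ord _ 2 (fun a => prefix_cyl W m.+1 (upd s m a))).
apply/seteqP; split => [t h|t [a _ h] i im Wi].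
  exists (heapify t m) => /=; first by rewrite ltn_ord.
  move=> i; rewrite inord_val ltnS leq_eqVlt => /orP[/eqP -> _|im Wi]; first by rewrite upd_eq.
  by rewrite upd_neq ?h // ltn_eqF.
by rewrite h ?upd_neq // ?ltn_eqF // ltnW.
Qed.

Lemma prefix_cyl_triv W m s : W (decode n m) ->
  trivIset setT (fun a : 'I_3 => prefix_cyl W m.+1 (upd s m a)).
Proof.
move=> Wm a c _ _ [t [h1 h2]].
by have := h1 m (ltnSn _) Wm; rewrite h2 // !upd_eq.
Qed.

Definition prefix_cyls W : set (set T) :=
  [set A | A = set0 \/ exists m s, A = prefix_cyl W m s].

Lemma prefix_cyls_setI W : setI_closed (prefix_cyls W).
Proof.
have le m m' s s' : (m <= m')%N ->
    prefix_cyls W (prefix_cyl W m s `&` prefix_cyl W m' s').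
  move=> mm'; have [ag|nag] := pselect (forall i, (i < m)%N -> W (decode n i) -> s i = s' i).
    right; exists m', s'; apply: setIidr => t h i im Wi.
    by rewrite ag // h // (leq_trans im).
  left; apply/seteqP; split => // t [h1 h2]; apply: nag => i im Wi.
  by rewrite -h1 // h2 // (leq_trans im).
move=> A B [->|[m [s ->]]]; first by rewrite set0I; left.
move=> [->|[m' [s' ->]]]; first by rewrite setI0; left.
by have [/le//|/ltnW /le] := leqP m m'; rewrite setIC; apply.
Qed.

Lemma prefix_cyl_coord W m s : coord_salgebra W (prefix_cyl W m s).
Proof.
pose T' := g_sigma_algebraType (cylinders W : set (set (spins V 2))).
suff : measurable (prefix_cyl W m s : set T') by [].
elim: m => [|m IH]; first by rewrite prefix_cyl0; exact: measurableT.
have [Wm|Wm] := pselect (W (decode n m)); last by rewrite prefix_cylS_out.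
rewrite prefix_cylS_in //; apply: measurableI => //.
by apply: sub_sigma_algebra; exists (decode n m) => //; exists (s m).
Qed.

(** The event that a single spin takes a given value is recovered by splitting
    over all the preceding coordinates, one at a time. *)
Lemma coord_salgebraE W : coord_salgebra W = <<s prefix_cyls W >>.
Proof.
apply/seteqP; split; apply: smallest_sub; try exact: smallest_sigma_algebra.
  move=> _ [v Wv [a _ <-]].
  pose T' := g_sigma_algebraType (prefix_cyls W : set (set (spins V 2))).
  suff H d m s : (m + d)%N = code v ->
      measurable (prefix_cyl W m s `&` [set t | t v = a] : set T').
    have := H (code v) 0%N (fun=> ord0) (add0n _); rewrite prefix_cyl0 setTI; exact.
  elim: d m s => [|d IH] m s; rewrite ?addn0 ?addnS => mE.
    apply: sub_sigma_algebra; right; exists m.+1, (upd s m a).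
    have vE : v = decode n m by rewrite mE codeK.
    rewrite prefix_cylS_in -?vE // upd_eq; congr (_ `&` _).
    by apply: prefix_cyl_ext => i im; rewrite upd_neq // ltn_eqF.
  have [Wm|Wm] := pselect (W (decode n m)); last first.
    by rewrite -prefix_cylS_out //; apply: IH; rewrite addSn.
  rewrite prefix_cyl_bigU // big_distrl /=.
  by apply: bigsetU_measurable => c _; apply: IH; rewrite addSn.
move=> A [->|[m [s ->]]]; last exact: prefix_cyl_coord.
by have [] := smallest_sigma_algebra setT (cylinders W : set (set T)).
Qed.

Lemma measurable_prefix_cyl W m s : measurable (prefix_cyl W m s : set T).
Proof.
have H : coord_salgebra W `<=` (measurable : set (set T)).
  apply: sub_smallest2r; first exact: smallest_sigma_algebra.
  by move=> _ [v _ [a _ <-]]; exists v => //; exists a.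
exact: H (@prefix_cyl_coord W m s).
Qed.

End PrefixCylinders.

Lemma measurable_cst_set d (T : measurableType d) (A : Prop) :
  measurable [set _ : T | A]%classic.
Proof.
have [a|a] := pselect A.
  by rewrite (_ : mkset _ = setT); [exact: measurableT|apply/seteqP; split].
by rewrite (_ : mkset _ = set0); [exact: measurable0|apply/seteqP; split].
Qed.

Section PrefixMasses.
Variables (n : nat) (R : realType).
Notation V := (seq 'I_n.+1).
Notation T := (config V 2).
Local Open Scope classical_set_scope.

Lemma probability_prefix_ext (mu nu : probability T R) :
  (forall m s, mu (prefix_cyl setT m s) = nu (prefix_cyl setT m s)) ->
  forall A : set T, measurable A -> mu A = nu A.
Proof.
move=> H; apply: (@measure_unique _ _ _ (prefix_cyls setT) (fun=> setT)).
- by rewrite -coord_salgebraE.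
- exact: prefix_cyls_setI.
- by move=> _; right; exists 0%N, (fun=> ord0); rewrite prefix_cyl0.
- by rewrite bigcup_const //; exists 0%N.
- by move=> A [->|[m [s ->]]]; [rewrite !measure0|exact: H].
- by move=> _; rewrite (le_lt_trans (probability_le1 _ _)) ?ltry.
Qed.

Lemma prefix_mass_split (mu : probability T R) m s :
  mu (prefix_cyl setT m s) = (\sum_(a < 3) mu (prefix_cyl setT m.+1 (upd s m a)))%E.
Proof.
rewrite prefix_cyl_bigU // measure_bigsetU_ord //; last exact: prefix_cyl_triv.
by move=> a; exact: measurable_prefix_cyl.
Qed.

End PrefixMasses.

Lemma upd_id s m : upd s m (s m) = s.
Proof. by apply/funext => i; rewrite /upd; case: eqP => // ->. Qed.

Lemma upd_upd s m a c : upd (upd s m a) m c = upd s m c.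
Proof. by apply/funext => i; rewrite /upd; case: eqP. Qed.

(** * Measures with prescribed cylinder masses *)
Section Kolmogorov.
Variables (n : nat) (R : realType).
Notation V := (seq 'I_n.+1).
Notation T := (config V 2).
Variable q : nat -> (nat -> 'I_3) -> R.
Hypothesis q0 : forall s, q 0 s = 1.
Hypothesis q_ge0 : forall m s, 0 <= q m s.
Hypothesis q_sum : forall m s, q m s = \sum_(a : 'I_3) q m.+1 (upd s m a).
Hypothesis q_ext : forall m s t, (forall i, (i < m)%N -> s i = t i) -> q m s = q m t.
Local Open Scope classical_set_scope.

(** The interval [0, 1) is cut into consecutive cells of length q 1 s, one for
    each value of the first spin, each of which is cut into cells of length
    q 2 s, and so on; this is the left end of the m-th cell of s. *)
Fixpoint left_end (m : nat) (s : nat -> 'I_3) : R :=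
  if m is m'.+1 then left_end m' s + \sum_(a : 'I_3 | (a < s m')%N) q m (upd s m' a) else 0.

Definition in_cell (m : nat) (s : nat -> 'I_3) (u : R) : bool := left_end m s <= u < left_end m s + q m s.

Lemma left_end_ext m s t : (forall i, (i < m)%N -> s i = t i) -> left_end m s = left_end m t.
Proof.
elim: m => [//|m IH] h /=; rewrite IH => [|i im]; last by rewrite h // ltnW.
rewrite h //; congr (_ + _); apply: eq_bigr => a _; apply: q_ext => i.
rewrite ltnS leq_eqVlt => /orP[/eqP ->|im]; first by rewrite !upd_eq.
by rewrite !upd_neq ?h ?ltn_eqF // ltnW.
Qed.

Lemma in_cell_ext m s t u : (forall i, (i < m)%N -> s i = t i) -> in_cell m s u = in_cell m t u.
Proof. by move=> h; rewrite /in_cell (left_end_ext h) (q_ext h). Qed.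

Lemma left_end_upd m s a :
  left_end m.+1 (upd s m a) = left_end m s + \sum_(c : 'I_3 | (c < a)%N) q m.+1 (upd s m c).
Proof.
rewrite /= upd_eq; congr (_ + _).
  by apply: left_end_ext => i im; rewrite upd_neq // ltn_eqF.
by apply: eq_bigr => c _; rewrite upd_upd.
Qed.

Lemma sum_ord3_lt (F : 'I_3 -> R) (a : nat) : (a <= 3)%N ->
  \sum_(c : 'I_3 | (c < a)%N) F c =
  (if (0 < a)%N then F ord0 else 0) + (if (1 < a)%N then F (inord 1) else 0) +
  (if (2 < a)%N then F (inord 2) else 0).
Proof.
move=> a3; rewrite big_mkcond !big_ord_recl big_ord0 /= addr0 -addrA.
have -> : lift ord0 ord0 = inord 1 :> 'I_3 by apply/val_inj; rewrite /= inordK.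
by have -> : lift ord0 (lift ord0 ord0) = inord 2 :> 'I_3 by apply/val_inj; rewrite /= inordK.
Qed.

Lemma ord3_ind (P : 'I_3 -> Prop) : P ord0 -> P (inord 1) -> P (inord 2) -> forall a, P a.
Proof.
move=> P0 P1 P2 a; rewrite -[a]inord_val; case: a => -[|[|[|//]]] h //=.
by have -> : inord 0 = ord0 :> 'I_3 by apply/val_inj; rewrite /= inordK.
Qed.

Lemma in_cell_sub m s u : in_cell m.+1 s u -> in_cell m s u.
Proof.
rewrite -{1}(upd_id s m) /in_cell left_end_upd (q_sum m s).
have e : \sum_(a : 'I_3) q m.+1 (upd s m a) = \sum_(a : 'I_3 | (a < 3)%N) q m.+1 (upd s m a).
  by apply: eq_bigl => a; rewrite ltn_ord.
rewrite e !sum_ord3_lt //; last exact/ltnW/ltn_ord.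
have := q_ge0 m.+1 (upd s m ord0); have := q_ge0 m.+1 (upd s m (inord 1)).
have := q_ge0 m.+1 (upd s m (inord 2)).
by elim/ord3_ind: (s m) => /=; rewrite ?inordK //=; lra.
Qed.

Lemma in_cell_cover m s u : in_cell m s u -> exists a, in_cell m.+1 (upd s m a) u.
Proof.
rewrite /in_cell (q_sum m s) => h.
have e : \sum_(a : 'I_3) q m.+1 (upd s m a) = \sum_(a : 'I_3 | (a < 3)%N) q m.+1 (upd s m a).
  by apply: eq_bigl => a; rewrite ltn_ord.
rewrite e sum_ord3_lt //= in h; case/andP: h => h1 h2.
set Q0 := q _ (upd s m ord0) in h2; set Q1 := q _ _ in h2; set Q2 := q _ _ in h2.
have [h|h] := ltP u (left_end m s + Q0).
  by exists ord0; rewrite left_end_upd sum_ord3_lt //= -/Q0; lra.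
have [h'|h'] := ltP u (left_end m s + Q0 + Q1).
  by exists (inord 1); rewrite left_end_upd sum_ord3_lt ?inordK //= -/Q0 -/Q1; lra.
by exists (inord 2); rewrite left_end_upd sum_ord3_lt ?inordK //= -/Q0 -/Q1 -/Q2; lra.
Qed.

Lemma in_cell_inj m s u a c :
  in_cell m.+1 (upd s m a) u -> in_cell m.+1 (upd s m c) u -> a = c.
Proof.
rewrite /in_cell !left_end_upd.
have := q_ge0 m.+1 (upd s m ord0); have := q_ge0 m.+1 (upd s m (inord 1)).
have := q_ge0 m.+1 (upd s m (inord 2)).
elim/ord3_ind: a; elim/ord3_ind: c => //; rewrite !sum_ord3_lt ?inordK //= => ? ? ? /andP[? ?] /andP[? ?];
  exfalso; lra.
Qed.

(** The first m spins of the configuration whose cells contain u. *)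
Fixpoint digits (u : R) (m : nat) : nat -> 'I_3 :=
  if m is m'.+1 then
    let s := digits u m' in upd s m' (odflt ord0 [pick a | in_cell m (upd s m' a) u])
  else fun=> ord0.

Lemma digits_cell u m : 0 <= u < 1 -> in_cell m (digits u m) u.
Proof.
move=> u01; elim: m => [|m IH]; first by rewrite /in_cell /= q0 add0r.
rewrite [digits _ _]/=; case: pickP => //= no.
by have [a] := in_cell_cover IH; rewrite no.
Qed.

Lemma digits_unique u m s : in_cell m s u -> forall i, (i < m)%N -> digits u m i = s i.
Proof.
elim: m s => [//|m IH] s h i; have hm := in_cell_sub h.
have e j : (j < m)%N -> digits u m j = s j by exact: IH.
have u01 : 0 <= u < 1.
  elim: (m.+1) s h {IH hm e} => [|k IHk] s; first by rewrite /in_cell /= q0 add0r.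
  by move/in_cell_sub; exact: IHk.
rewrite ltnS leq_eqVlt => /orP[/eqP ->|im]; last first.
  by rewrite /= upd_neq ?e // ltn_eqF.
have h2 := digits_cell m.+1 u01.
apply: (@in_cell_inj m s u).
  rewrite (@in_cell_ext _ _ (digits u m.+1)) // => j.
  rewrite ltnS leq_eqVlt => /orP[/eqP ->|jm]; first by rewrite upd_eq.
  by rewrite upd_neq ?ltn_eqF // -e // [RHS]/= upd_neq // ltn_eqF.
by rewrite upd_id.
Qed.

Lemma digits_stable u m k i : (i < m <= k)%N -> digits u k i = digits u m i.
Proof.
move=> /andP[im mk]; elim: k mk => [|k IH] mk; first by lia.
rewrite leq_eqVlt in mk; case/orP: mk => [/eqP -> //|mk].
by rewrite /= upd_neq ?IH // ltn_eqF // (leq_trans im).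
Qed.

Definition sample (u : R) : T := fun v => digits u (code v).+1 (code v).

Lemma sample_heap u i : heapify (sample u) i = digits u i.+1 i.
Proof. by rewrite /heapify /sample /= decodeK. Qed.

Lemma sample_prefix u m s : 0 <= u < 1 -> prefix_cyl setT m s (sample u) <-> in_cell m s u.
Proof.
move=> u01; split=> [h|h i im _].
  rewrite (@in_cell_ext _ _ (digits u m)); first exact: digits_cell.
  by move=> i im; rewrite -h // sample_heap -(@digits_stable u i.+1 m) // ltnSn.
by rewrite sample_heap -(digits_unique h im) (@digits_stable u i.+1 m) // ltnSn.
Qed.

Lemma sample_out u : ~~ (0 <= u < 1) -> sample u = fun=> ord0.
Proof.
move=> u01; have nc m s : in_cell m s u = false.
  apply/negP => h; move/negP: u01; apply.
  elim: m s h => [|k IHk] s; first by rewrite /in_cell /= q0 add0r.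
  by move/in_cell_sub; exact: IHk.
have d m : digits u m = fun=> ord0.
  elim: m => [//|m IH] /=; case: pickP => [a|_]; first by rewrite nc.
  by apply/funext => i; rewrite /upd IH; case: eqP.
by apply/funext => v; rewrite /sample d.
Qed.

Let D : set (measurableTypeR R) := `[0, 1[%classic.

Let preimage_sample m s : sample @^-1` (prefix_cyl setT m s) =
  ([set` `[left_end m s, left_end m s + q m s[%R] `&` D) `|`
  (~` D `&` [set u | @prefix_cyl n setT m s (fun=> ord0)]).
Proof.
apply/seteqP; split => u /=.
  move=> h; have [uD|uD] := boolP (0 <= u < 1).
    left; rewrite /D /= !in_itv /=; split => //.
    by apply/(sample_prefix _ _ uD).
  by right; rewrite /D /= in_itv /=; split; [exact/negP|rewrite -(sample_out uD)].
rewrite /D /= !in_itv /=; case=> [[h uD]|[/negP uD h]].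
  by apply/(sample_prefix _ _ uD).
by rewrite sample_out.
Qed.

Let mD : measurable D. Proof. exact: measurable_itv. Qed.

Lemma measurable_sample : @measurable_fun _ _ (measurableTypeR R) T setT sample.
Proof.
apply: (measurability (prefix_cyls setT)); first by rewrite -coord_salgebraE.
move=> _ [_ [->|[m [s ->]]] <-]; first by rewrite preimage_set0 setI0; exact: measurable0.
rewrite setTI preimage_sample; apply: measurableU; apply: measurableI => //.
- exact: measurableC.
- exact: measurable_cst_set.
Qed.

Lemma in_cell_01 m s : 0 <= left_end m s /\ left_end m s + q m s <= 1.
Proof.
elim: m s => [|m IH] s; first by rewrite /= q0 add0r; split.
have [h1 h2] := IH s; rewrite -{1 2 3}(upd_id s m) left_end_upd.
move: h2; rewrite (q_sum m s).
have e : \sum_(a : 'I_3) q m.+1 (upd s m a) = \sum_(a : 'I_3 | (a < 3)%N) q m.+1 (upd s m a).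
  by apply: eq_bigl => a; rewrite ltn_ord.
rewrite e !sum_ord3_lt //; last exact/ltnW/ltn_ord.
have := q_ge0 m.+1 (upd s m ord0); have := q_ge0 m.+1 (upd s m (inord 1)).
have := q_ge0 m.+1 (upd s m (inord 2)).
by elim/ord3_ind: (s m) => /=; rewrite ?inordK //=; split; lra.
Qed.

Let P := @uniform_prob R 0 1 ltr01.

Let P_itv (a b : R) : 0 <= a -> a <= b -> b <= 1 -> P `[a, b[%classic = (b - a)%:E.
Proof.
move=> a0 ab b1; rewrite /P /uniform_prob (eq_integral (fun=> 1%:E)); last first.
  move=> x; rewrite inE /= in_itv /= => /andP[ax xb].
  by rewrite /uniform_pdf subr0 invr1 ifT //; apply/andP; split; lra.
rewrite integral_cst //= mul1e lebesgue_measure_itv /= lte_fin.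
by case: ltP => // ba; rewrite (_ : b - a = 0) //; lra.
Qed.

(** A uniform point of [0, 1) falls in the m-th cell of s with probability q m s,
    so the configuration [sample] that it encodes has the required law. *)
Theorem kolmogorov_extension : exists mu : probability T R,
  forall m s, mu (prefix_cyl setT m s) = (q m s)%:E.
Proof.
pose X : {mfun measurableTypeR R >-> T} :=
  @mfun_Sub _ _ (measurableTypeR R) T _ (mem_set measurable_sample).
exists (distribution P X) => m s.
rewrite /distribution /pushforward /= preimage_sample.
have [c1 c2] := in_cell_01 m s; have qq := q_ge0 m s.
rewrite measureU; last 3 first.
- by apply: measurableI => //; exact: measurable_itv.
- by apply: measurableI; [exact: measurableC|exact: measurable_cst_set].
- by apply/seteqP; split => // u [[_ ?] [? _]].
rewrite setIidl; last first.
  by move=> u; rewrite /D /= !in_itv /= => /andP[? ?]; apply/andP; split; lra.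
have E1 : P `[left_end m s, left_end m s + q m s[%classic = (q m s)%:E.
  by rewrite P_itv //; [congr EFin; lra|lra].
have E2 : P (~` D `&` [set u | @prefix_cyl n setT m s (fun=> ord0)]) = 0%E.
  apply/eqP; rewrite eq_le measure_ge0 andbT.
  have <- : P (~` D) = 0%E.
    have PD : P D = 1%E by rewrite /D P_itv ?ler01 ?subr0.
    by transitivity (1 - P D)%E; [exact: probability_setC|rewrite PD subee].
  apply: le_measure; last exact: subIsetl.
    by rewrite inE; apply: measurableI; [exact: measurableC|exact: measurable_cst_set].
  by rewrite inE; exact: measurableC.
rewrite -[RHS]adde0.
exact: (congr2 (fun x y : \bar R => (x + y)%E) E1 E2).
Qed.

End Kolmogorov.

(** * Events and specifications depending on finitely many vertices *)
Section FiniteDependence.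
Variable n : nat.
Notation V := (seq 'I_n.+1).
Notation T := (config V 2).
Notation adj := (@tree_adj n.+1).
Implicit Types (W : set V) (s : nat -> 'I_3).
Local Open Scope classical_set_scope.

Lemma coord_salgebra_sub W : coord_salgebra W `<=` (measurable : set (set T)).
Proof.
apply: sub_smallest2r; first exact: smallest_sigma_algebra.
by move=> _ [v _ [a _ <-]]; exists v => //; exists a.
Qed.

(** An event decided by finitely many coordinates of W is a finite union of
    cylinders. *)
Lemma coord_salgebra_dep W M (A : set T) :
  (forall t t' : T, (forall i, (i < M)%N -> W (decode n i) -> heapify t i = heapify t' i) ->
    A t -> A t') -> coord_salgebra W A.
Proof.
move=> dep; pose T' := g_sigma_algebraType (cylinders W : set (set (spins V 2))).
suff H d m s : (m + d)%N = M -> measurable (A `&` prefix_cyl W m s : set T').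
  by have := H M 0%N (fun=> ord0) (add0n _); rewrite prefix_cyl0 setIT.
elim: d m s => [|d IH] m s; rewrite ?addn0 ?addnS => mE.
  have [[t [At ht]]|no] := pselect (exists t, A t /\ prefix_cyl W m s t).
    rewrite (_ : A `&` _ = prefix_cyl W m s); first exact: prefix_cyl_coord.
    apply: setIidr => t' ht'; apply: (dep t) => // i iM Wi.
    by rewrite ht ?mE // ht' ?mE.
  rewrite (_ : A `&` _ = set0); first exact: measurable0.
  by apply/seteqP; split => // t [? ?]; apply: no; exists t.
have [Wm|Wm] := pselect (W (decode n m)); last first.
  by rewrite -prefix_cylS_out //; apply: IH; rewrite addSn.
rewrite prefix_cyl_bigU // big_distrr /=.
by apply: bigsetU_measurable => c _; apply: IH; rewrite addSn.
Qed.

Lemma heapifyK (s : nat -> 'I_3) : heapify (s \o @code n : T) = s.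
Proof. by apply/funext => i; rewrite /heapify /= decodeK. Qed.

Variables (R : realType).

(** The mass of a cylinder is the sum of the masses of its refinements, so it
    is enough to compare long cylinders. *)
Lemma prefix_measures_eq (m1 m2 : {measure set T -> \bar R}) W M :
  (forall m s, (M <= m)%N -> m1 (prefix_cyl W m s) = m2 (prefix_cyl W m s)) ->
  forall m s, m1 (prefix_cyl W m s) = m2 (prefix_cyl W m s).
Proof.
move=> H m s; have [|mM] := leqP M m; first exact: H.
have [d] : exists d, (m + d)%N = M by exists (M - m)%N; rewrite subnKC // ltnW.
elim: d m s {mM} => [|d IH] m s; first by rewrite addn0 => mE; apply: H; rewrite mE.
rewrite addnS -addSn => mE.
have [Wm|Wm] := pselect (W (decode n m)); last by rewrite -prefix_cylS_out // IH.
rewrite prefix_cyl_bigU // !measure_bigsetU_ord //; try exact: prefix_cyl_triv;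
  try by move=> a; exact: measurable_prefix_cyl.
by apply: eq_bigr => a _; exact: IH.
Qed.

Lemma measures_coord_eq (m1 m2 : {measure set T -> \bar R}) W M :
  (m2 setT < +oo)%E ->
  (forall m s, (M <= m)%N -> m1 (prefix_cyl W m s) = m2 (prefix_cyl W m s)) ->
  forall B, coord_salgebra W B -> m1 B = m2 B.
Proof.
move=> fin H B; rewrite coord_salgebraE.
have H' := prefix_measures_eq H.
have e m s : m1 (prefix_cyl W m s) = m2 (prefix_cyl W m s) by exact: H'.
apply: (@g_sigma_algebra_measure_unique _ _ _ (prefix_cyls W) _ (fun=> setT)).
- by move=> _ [->|[m [s ->]]]; [exact: measurable0|exact: measurable_prefix_cyl].
- by move=> _; right; exists 0%N, (fun=> ord0); rewrite prefix_cyl0.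
- by rewrite bigcup_const //; exists 0%N.
- exact: prefix_cyls_setI.
- by move=> A [->|[m [s ->]]]; [rewrite !measure0|exact: e].
- by move=> _; rewrite -(prefix_cyl0 W (fun=> ord0)) e prefix_cyl0.
Qed.

Lemma bdry_code (U : {fset V}) M x : (forall v, touches U v -> (v < M)%N) ->
  x \in bdry adj U -> (code x < M)%N.
Proof.
move=> hM /in_bdry_tree[_ [z zU /tree_adjP[[z0 xz]|[x0 zx]]]].
  have : (code z < M)%N by apply: hM; rewrite /touches codeK zU.
  by apply: leq_ltn_trans; rewrite xz /heap_parent (leq_trans (leq_div _ _)) // leq_pred.
by apply: hM; rewrite /touches x0 -zx !codeK zU orbT.
Qed.

Lemma touches_bound (U : {fset V}) : exists M, forall v, touches U v -> (v < M)%N.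
Proof.
pose K := (\max_(x <- U) code x)%N.
have hK x : x \in U -> (code x <= K)%N by move=> xU; apply: leq_bigmax_seq.
exists (n.+1 * K + n.+2)%N => v /orP[vU|/andP[v0 pU]].
  by have := hK _ vU; rewrite decodeK; nia.
have := hK _ pU; rewrite decodeK /heap_parent => h.
have := divn_eq v.-1 n.+1; have := ltn_pmod v.-1 (ltn0Sn n); nia.
Qed.

Variable lam : R.
Hypothesis l0 : 0 < lam.

Lemma local_spec_ext (U : {fset V}) (t t' : T) :
  (forall x, x \in closed_nbhd adj U -> t x = t' x) ->
  local_spec adj lam U t = local_spec adj lam U t'.
Proof.
move=> h; rewrite /local_spec.
have e A : (fun s : {ffun closed_nbhd adj U -> 'I_3} => agree A s t) = (fun s : {ffun closed_nbhd adj U -> 'I_3} => agree A s t').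
  apply/funext => s; apply: eq_forallb => x.
  by rewrite h // (valP x).
by rewrite !e.
Qed.

Lemma local_spec_override (U : {fset V}) (eta : {ffun U -> 'I_3}) (t t' : T) :
  (forall x, x \in bdry adj U -> t x = t' x) ->
  local_spec adj lam U (override eta t) = local_spec adj lam U (override eta t').
Proof.
move=> h; apply: local_spec_ext => x; rewrite /closed_nbhd in_fsetU => xW.
have [xU|xU] := boolP (x \in U).
  by rewrite -[x]/(val [` xU]%fset) !override_in.
by rewrite !override_out // h //; move: xW; rewrite (negbTE xU).
Qed.

Lemma bdry_ok_override (U : {fset V}) (eta : {ffun U -> 'I_3}) (t : T) :
  bdry_ok adj U (override eta t) <-> bdry_ok adj U t.
Proof.
have bN x : x \in bdry adj U -> x \notin U by case/in_bdry_tree.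
by split=> h x y xb yb xy; have := h x y xb yb xy; rewrite !override_out ?bN.
Qed.

Lemma override_override (U : {fset V}) (eta eta' : {ffun U -> 'I_3}) (t : T) :
  override eta (override eta' t) = override eta t.
Proof.
apply/funext => x; have [xU|xU] := boolP (x \in U); last by rewrite !override_out.
by rewrite -[x]/(val [` xU]%fset) !override_in.
Qed.

(** The sum is 1, except for a contradictory boundary condition, where it
    is 0. *)
Lemma sum_local_spec_le1 (U : {fset V}) (t : T) :
  \sum_(eta : {ffun U -> 'I_3}) local_spec adj lam U (override eta t) <= 1.
Proof.
have [/asboolP ok|/asboolP nok] := boolP `[< bdry_ok adj U t >]; last first.
  rewrite big1 // => eta _; apply: local_spec_conflict => //.
  by move/bdry_ok_override.
under eq_bigr => eta _.
  rewrite local_spec_ok //; [|exact: tree_adj_sym|exact: in_bdry_tree|exact/bdry_ok_override].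
  under eq_bigr do rewrite override_override.
  over.
by rewrite -mulr_suml divff // gt_eqF // loc_partition_gt0.
Qed.

Lemma local_spec_le1 (U : {fset V}) (t : T) : local_spec adj lam U t <= 1.
Proof.
apply: le_trans (sum_local_spec_le1 U t).
rewrite (bigD1 (restr U t)) //= override_restr // lerDl sumr_ge0 // => eta _.
by apply: local_spec_ge0 => //; [exact: tree_adj_sym|exact: in_bdry_tree].
Qed.

Lemma prefix_cyl_restr (U : {fset V}) (eta : {ffun U -> 'I_3}) m (t : T) :
  (forall x, x \in U -> (code x < m)%N) ->
  prefix_cyl (~` [set` U]) m (heapify t) `&` [set z | restr U z = eta] =
  prefix_cyl setT m (heapify (override eta t)).
Proof.
move=> hU; apply/seteqP; split => z.
  move=> [h /= <-] i im _; have [iU|iU] := boolP (decode n i \in U).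
    by rewrite /heapify /= -[decode n i]/(val [` iU]%fset) override_in ffunE.
  by rewrite h //=; [rewrite /heapify /= override_out|exact/negP].
move=> h; split=> [i im /= /negP iU|/=].
  by rewrite h // /heapify /= override_out.
apply/ffunP => u; rewrite ffunE.
have := h (code (val u)) (hU _ (valP u)) I.
by rewrite /heapify /= codeK override_in.
Qed.

Lemma measurable_restr (U : {fset V}) (eta : {ffun U -> 'I_3}) :
  measurable ([set z | restr U z = eta] : set T).
Proof.
have [M hM] := touches_bound U.
apply: (@coord_salgebra_sub setT); apply: (@coord_salgebra_dep _ M) => t t' h /= <-.
apply/ffunP => u; rewrite !ffunE.
have := h (code (val u)); rewrite /heapify /= codeK => -> //.
by apply: hM; rewrite /touches codeK (valP u).
Qed.

Lemma measure_restr_sum (mu : {measure set T -> \bar R}) (U : {fset V}) (B : set T) :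
  measurable B ->
  mu B = (\sum_(eta : {ffun U -> 'I_3}) mu (B `&` [set z | restr U z = eta]))%E.
Proof.
move=> mB; pose F (eta : {ffun U -> 'I_3}) := B `&` [set z | restr U z = eta].
transitivity (mu (\bigcup_(eta in [set: {ffun U -> 'I_3}]) F eta)).
  congr (mu _); apply/seteqP; split => [z Bz|z [eta _ []//]].
  by exists (restr U z).
rewrite measure_fin_bigcup //.
- rewrite (fsbigE (enum {: {ffun U -> 'I_3}})) ?enum_uniq //=.
    by rewrite big_enum_cond; apply: eq_bigl => i; rewrite mem_setT.
  by move=> i _; rewrite mem_enum.
- exact: finite_finset.
- by move=> eta eta' _ _ [z [[_ /= <-] [_ /= <-]]].
- by move=> eta _; apply: measurableI => //; exact: measurable_restr.
Qed.

End FiniteDependence.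

(** * Existence *)
Section Density.
Context d (T : measurableType d) (R : realType).
Variables (mu : {measure set T -> \bar R}) (f : T -> R).
Local Open Scope classical_set_scope.

(** The hypotheses are arguments of the definition so that the measure structure
    below can be found by inference. *)
Definition density (f0 : forall t, 0 <= f t) (mf : measurable_fun setT f)
  : set T -> \bar R := fun B => (\int[mu]_(t in B) (f t)%:E)%E.

Hypotheses (f0 : forall t, 0 <= f t) (mf : measurable_fun setT f).

Let density0 : density f0 mf set0 = 0%E.
Proof. by rewrite /density integral_set0. Qed.

Let density_ge0 B : (0 <= density f0 mf B)%E.
Proof. by apply: integral_ge0 => t _; rewrite lee_fin. Qed.

Let density_sigma_additive : semi_sigma_additive (density f0 mf).
Proof.
move=> /= F mF tF mUF; rewrite /density; apply: cvg_toP.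
  apply: ereal_nondecreasing_is_cvgn => m n mn.
  apply: lee_sum_nneg_natr => // k _ _.
  by apply: integral_ge0 => /= x Fkx; rewrite lee_fin.
rewrite ge0_integral_bigcup //=.
- by apply/measurable_EFinP; apply: (measurable_funS measurableT _ mf).
- by move=> x _; rewrite lee_fin.
Qed.

HB.instance Definition _ := isMeasure.Build _ _ _ (density f0 mf)
  density0 density_ge0 density_sigma_additive.

End Density.

Section Existence.
Variables (n : nat) (R : realType) (lam : R).
Hypothesis l0 : 0 < lam.
Notation V := (seq 'I_n.+1).
Notation T := (config V 2).
Notation adj := (@tree_adj n.+1).
Local Open Scope classical_set_scope.

Variables (r : nat -> nat -> R) (c : nat -> R) (mu : probability T R).
Hypothesis muE : forall m s,
  mu (prefix_cyl setT m s) = (c m * cut_weight n lam r m s)%:E.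

Let q m s := c m * cut_weight n lam r m s.

Lemma cut_measure_allowable : {ae mu, forall t, allowable adj t}.
Proof.
suff : {ae mu, forall t v, edge_ok n (heapify t) v}.
  by apply: negligibleS => t /= h1 h2; apply: h1; apply/allowable_heap.
apply: ae_foralln => v.
suff H k m s : (m + k)%N = v.+1 ->
    mu.-negligible (~` [set t | edge_ok n (heapify t) v] `&` prefix_cyl setT m s).
  by have := H v.+1 0%N (fun=> ord0) (add0n _); rewrite prefix_cyl0 setIT.
elim: k m s => [|k IH] m s.
  rewrite addn0 => mE.
  have [sv|sv] := boolP (edge_ok n s v).
    apply: (@negligibleS _ _ _ _ set0); last exact: negligible_set0.
    move=> t [/= nok h]; apply: nok; move: sv; rewrite /edge_ok.
    rewrite (@parent_spin_ext n (heapify t) s m v); first by rewrite h // mE.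
      by rewrite mE.
    by move=> i im; rewrite h.
  apply: (@negligibleS _ _ _ _ (prefix_cyl setT m s)); first exact: subIsetr.
  apply/negligibleP; first exact: measurable_prefix_cyl.
  suff E : mu (prefix_cyl setT m s) = 0%E by exact: E.
  rewrite muE /cut_weight /heap_weight (bigD1_seq v) ?iota_uniq //=; last first.
    by rewrite mem_index_iota mE ltnS leqnn.
  by rewrite (negbTE sv) mulr0 !mul0r mulr0.
rewrite addnS -addSn => mE.
rewrite prefix_cyl_bigU // !big_ord_recl big_ord0 setU0 !setIUr.
by apply: negligibleU; [|apply: negligibleU]; exact: IH.
Qed.

(** Both sides of the defining identity of a conditional probability are finite
    measures in the conditioning event, so cylinders outside U suffice.  On a
    long one the specification is constant, and the identity is
    [cut_weight_local] summed over the configurations on U. *)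
Lemma local_spec_cond_prob (U : {fset V}) (eta : {ffun U -> 'I_3}) :
  is_cond_prob mu (coord_salgebra (~` [set` U])) [set s | restr U s = eta]
    (fun t => local_spec adj lam U (override eta t)).
Proof.
have [M hM] := touches_bound U.
set W := ~` [set` U]; set f := (X in is_cond_prob _ _ _ X).
have hU x : x \in U -> (code x < M)%N by move=> xU; apply: hM; rewrite /touches codeK xU.
have sym := @tree_adj_sym n; have bd := @in_bdry_tree n.+1.
have fdep (t t' : T) : (forall i, (i < M)%N -> W (decode n i) -> heapify t i = heapify t' i) ->
    f t = f t'.
  move=> h; apply: local_spec_override => x xb.
  have := h (code x); rewrite /heapify /= codeK; apply; first exact: bdry_code xb.
  by apply/negP; case/in_bdry_tree: xb.
have mfF (B : set R) : coord_salgebra W (f @^-1` B).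
  by apply: (@coord_salgebra_dep _ _ M) => t t' h /=; rewrite (fdep _ _ h).
have f0 t : 0 <= f t by exact: local_spec_ge0.
have mf : measurable_fun setT f.
  by move=> _ B mB; rewrite setTI; apply: coord_salgebra_sub (mfF B).
split => //.
  apply: measurable_bounded_integrable => //.
    by rewrite (le_lt_trans (probability_le1 _ _)) ?ltry.
  exists 1; split => // x x1 t _ /=; rewrite ger0_norm //.
  by apply: le_trans (ltW x1); exact: local_spec_le1.
move=> B FB; have mA := measurable_restr eta.
rewrite setIC -/(mrestr mu mA B) -/(density mu f0 mf B).
apply: (@measures_coord_eq n R _ _ W M) FB.
  by rewrite /= /mrestr setTI (le_lt_trans (probability_le1 _ _)) ?ltry.
move=> m s Mm; rewrite /= /density /mrestr.
pose t : T := s \o @code n.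
have st : s = heapify t by rewrite heapifyK.
have hUm x : x \in U -> (code x < m)%N by move=> /hU h; exact: leq_trans Mm.
have cell (e : {ffun U -> 'I_3}) :
    mu (prefix_cyl W m s `&` [set z | restr U z = e]) = (q m (heapify (override e t)))%:E.
  by rewrite st prefix_cyl_restr.
rewrite (eq_integral (fun=> (f t)%:E)); last first.
  move=> z; rewrite inE => zs; congr EFin; apply: fdep => i iM Wi.
  by rewrite -st zs // (leq_trans iM).
rewrite integral_cst; last exact: measurable_prefix_cyl.
suff E : ((f t)%:E * mu (prefix_cyl W m s) =
    mu (prefix_cyl W m s `&` [set z | restr U z = eta]))%E by exact: E.
have total : mu (prefix_cyl W m s) =
    (\sum_(e : {ffun U -> 'I_3}) (q m (heapify (override e t)))%:E)%E.
  transitivity (\sum_(e : {ffun U -> 'I_3}) mu (prefix_cyl W m s `&` [set z | restr U z = e]))%E.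
    by apply: (measure_restr_sum mu U); exact: measurable_prefix_cyl.
  by apply: eq_bigr => e _; exact: cell.
rewrite cell total sumEFin -EFinM; congr EFin.
have tchm v : touches U v -> (v < m)%N by move=> /hM h; exact: leq_trans Mm.
have dlr (e : {ffun U -> 'I_3}) : q m (heapify (override e t)) * loc_weight adj lam U (override eta t) =
    q m (heapify (override eta t)) * loc_weight adj lam U (override e t).
  rewrite /q -[LHS]mulrA -[RHS]mulrA; congr (_ * _); refine (@cut_weight_local n R lam r U _ _ m tchm _) => x xU.
  by rewrite !override_out.
have ft : f t = local_spec adj lam U (override eta t) by [].
have [/asboolP ok|/asboolP nok] := boolP `[< bdry_ok adj U t >].
  rewrite ft local_spec_ok //; last exact/bdry_ok_override.
  under eq_bigr do rewrite override_override.
  have S : (\sum_(e : {ffun U -> 'I_3}) q m (heapify (override e t))) *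
      loc_weight adj lam U (override eta t) =
    q m (heapify (override eta t)) *
      \sum_(e : {ffun U -> 'I_3}) loc_weight adj lam U (override e t).
    by rewrite mulr_suml mulr_sumr; apply: eq_bigr => e _; exact: dlr.
  by rewrite mulrAC [loc_weight _ _ _ _ * _]mulrC S mulfK // gt_eqF // loc_partition_gt0.
(* a contradictory boundary condition has mass zero *)
rewrite ft local_spec_conflict // ?mul0r; last by move/bdry_ok_override.
rewrite /q; suff -> : cut_weight n lam r m (heapify (override eta t)) = 0 by rewrite mulr0.
move/existsNP: nok => [x /existsNP[y /not_implyP[xb /not_implyP[yb /not_implyP[xy nok]]]]].
have bN z : z \in bdry adj U -> z \notin U by case/in_bdry_tree.
have xm := bdry_code tchm xb; have ym := bdry_code tchm yb.
have [v vm nv] : exists2 v, (v < m)%N & ~~ edge_ok n (heapify (override eta t)) v.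
  case/tree_adjP: xy => -[z0 e]; [exists (code y) => //|exists (code x) => //].
    rewrite /edge_ok parent_spinE // /heapify /= -e !codeK !override_out ?bN // addnC.
    exact/negP.
  rewrite /edge_ok parent_spinE // /heapify /= -e !codeK !override_out ?bN //.
  exact/negP.
rewrite /cut_weight /heap_weight (bigD1_seq v) ?iota_uniq //=; last by rewrite mem_index_iota.
by rewrite (negbTE nv) mulr0 !mul0r.
Qed.

Lemma cut_measure_gibbs : is_gibbs adj lam mu.
Proof.
split; first exact: cut_measure_allowable.
move=> U; exists (fun eta t => local_spec adj lam U (override eta t)); split.
  exact: local_spec_cond_prob.
by apply: aeW => t; rewrite override_restr.
Qed.

End Existence.

(** * Uniqueness *)
Section GibbsDLR.
Variables (n : nat) (R : realType) (lam : R).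
Hypothesis l0 : 0 < lam.
Notation V := (seq 'I_n.+1).
Notation T := (config V 2).
Notation adj := (@tree_adj n.+1).
Local Open Scope classical_set_scope.

Variable nu : probability T R.
Hypothesis nuG : is_gibbs adj lam nu.

(** The Gibbs property only identifies the version f eta of the conditional
    probability with the specification on the event that the spins on U equal
    eta.  On the set where f eta differs from the specification, this event has
    mass zero; on the rest, f eta is integrated, which bounds the mass from
    above. *)
Lemma gibbs_spec_le (U : {fset V}) M (eta : {ffun U -> 'I_3}) (t : T) :
  (forall v, touches U v -> (v < M)%N) ->
  (nu (prefix_cyl (~` [set` U]) M (heapify t) `&` [set z | restr U z = eta]) <=
   (local_spec adj lam U (override eta t))%:E *
     nu (prefix_cyl (~` [set` U]) M (heapify t)))%E.
Proof.
move=> hM; set W := ~` [set` U]; set B := prefix_cyl W M (heapify t); set A := [set z | _].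
set g := local_spec _ _ _ _.
have [_ /(_ U)[f [fP fae]]] := nuG.
have [fF fint fcond] := fP eta.
have sA := @coord_salgebra_sub n W.
have mA : measurable A := measurable_restr eta.
have mB : measurable B := @measurable_prefix_cyl n W M (heapify t).
have FB : coord_salgebra W B := @prefix_cyl_coord n W M (heapify t).
pose D := f eta @^-1` [set g].
have FD : coord_salgebra W D by apply: fF; exact: measurable_set1.
have mD := sA _ FD.
have FBD : coord_salgebra W (B `&` D).
  pose T' := g_sigma_algebraType (cylinders W : set (set (spins V 2))).
  exact: (@measurableI _ T').
have gE z : B z -> A z -> local_spec adj lam U z = g.
  move=> Bz Az; rewrite /g -[eta]Az -{1}(@override_restr _ _ U z z) //.
  apply: local_spec_override => x xb.
  have xN : x \notin U by case/in_bdry_tree: xb.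
  have := Bz (code x) (bdry_code hM xb); rewrite /heapify /= codeK; apply.
  exact/negP.
have null : nu (B `&` A `&` ~` D) = 0%E.
  apply: measure_negligible.
    by apply: measurableI; [exact: measurableI|exact: measurableC].
  apply: negligibleS fae => z [[Bz Az] /= nD] fz; apply: nD.
  by rewrite /D /= -(gE z Bz Az) -fz Az.
have -> : nu (B `&` A) = nu (A `&` (B `&` D)).
  transitivity (nu (B `&` A `&` ~` D) + nu (B `&` A `&` D))%E.
    rewrite -measureU.
    - by rewrite -setIUr setUC setUv setIT.
    - by apply: measurableI; [exact: measurableI|exact: measurableC].
    - by apply: measurableI => //; exact: measurableI.
    - by apply/seteqP; split => // z [[_ ?] [_ ?]].
  by rewrite null add0e [B `&` A]setIC setIA.
rewrite -fcond // (eq_integral (fun=> g%:E)); last first.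
  by move=> z; rewrite inE => -[_ /= ->].
rewrite integral_cst; last exact: measurableI.
apply: lee_wpmul2l.
  by rewrite lee_fin; apply: local_spec_ge0 => //; [exact: tree_adj_sym|exact: in_bdry_tree].
by apply: le_measure; rewrite ?inE //; exact: measurableI.
Qed.

(** Summed over eta, the left sides of [gibbs_spec_le] make up the mass of the
    boundary event, while the specifications sum to at most 1; so none of the
    inequalities can be strict. *)
Lemma gibbs_spec (U : {fset V}) M (eta : {ffun U -> 'I_3}) (t : T) :
  (forall v, touches U v -> (v < M)%N) ->
  fine (nu (prefix_cyl setT M (heapify (override eta t)))) =
  local_spec adj lam U (override eta t) * fine (nu (prefix_cyl (~` [set` U]) M (heapify t))).
Proof.
move=> hM; set B := prefix_cyl _ M (heapify t).
have hU x : x \in U -> (code x < M)%N by move=> xU; apply: hM; rewrite /touches codeK xU.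
pose m (e : {ffun U -> 'I_3}) := fine (nu (prefix_cyl setT M (heapify (override e t)))).
pose g (e : {ffun U -> 'I_3}) := local_spec adj lam U (override e t).
have fin (A : set T) : measurable A -> nu A = (fine (nu A))%:E.
  by move=> mA; rewrite fineK // fin_num_measure.
have mB : measurable B := @measurable_prefix_cyl n _ M (heapify t).
have mE e : nu (B `&` [set z | restr U z = e]) = (m e)%:E.
  by rewrite /B prefix_cyl_restr // fin //; exact: measurable_prefix_cyl.
have le e : m e <= g e * fine (nu B).
  by have := gibbs_spec_le e t hM; rewrite -/B mE (fin _ mB) -EFinM lee_fin.
have tot : fine (nu B) = \sum_e m e.
  suff -> : nu B = (\sum_e (m e)%:E)%E by rewrite sumEFin.
  transitivity (\sum_e nu (B `&` [set z | restr U z = e]))%E.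
    exact: (measure_restr_sum nu U mB).
  by apply: eq_bigr => e _; exact: mE.
have b0 : 0 <= fine (nu B) by rewrite fine_ge0.
have : \sum_e (g e * fine (nu B) - m e) <= 0.
  rewrite sumrB -tot -mulr_suml subr_le0 ler_piMl //; exact: sum_local_spec_le1.
have ge0 e : 0 <= g e * fine (nu B) - m e by rewrite subr_ge0.
rewrite (bigD1 eta) //= => h; apply/eqP; rewrite eq_le -/(m eta) le /=.
have h2 : 0 <= \sum_(e | e != eta) (g e * fine (nu B) - m e) by apply: sumr_ge0.
by rewrite -subr_le0; move: h h2; rewrite /g; lra.
Qed.

(** The partition function depends on the boundary only, so it cancels between
    two configurations that agree there. *)
Lemma gibbs_cut M (s t : nat -> 'I_3) :
  (forall i, (M <= i <= n.+1 * M)%N -> s i = t i) ->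
  fine (nu (@prefix_cyl n setT (n.+1 * M).+1 s)) * cut_weight n lam (msg n lam s M 0) M t =
  fine (nu (@prefix_cyl n setT (n.+1 * M).+1 t)) * cut_weight n lam (msg n lam s M 0) M s.
Proof.
move=> st; have [M0|M0] := posnP M.
  have e i : (i < (n.+1 * M).+1)%N -> s i = t i by rewrite M0 => h; apply: st; rewrite M0; lia.
  rewrite (@prefix_cyl_ext n setT _ s t) //; congr (_ * _).
  by apply: cut_weight_ext => // i; rewrite M0.
set U := heap_prefix n M; set N := (n.+1 * M).+1.
have tch v : touches U v -> (v < N)%N.
  rewrite /touches !in_heap_prefix !decodeK /heap_parent /N => /orP[|/andP[v0]]; first by nia.
  by rewrite ltn_divLR // mulnC; lia.
pose z : T := s \o @code n.
have key (u : nat -> 'I_3) : (forall i, (M <= i <= n.+1 * M)%N -> s i = u i) ->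
   exists e : {ffun U -> 'I_3}, (@prefix_cyl n setT N u = prefix_cyl setT N (heapify (override e z))) /\
     cut_weight n lam (msg n lam s M 0) M u = loc_weight adj lam U (override e z).
  move=> su; pose e := restr U (u \o @code n : T); exists e.
  have eq i : (i < N)%N -> u i = heapify (override e z) i.
    move=> iN; rewrite /heapify /=; have [iU|iU] := boolP (decode n i \in U).
      by rewrite -[decode n i]/(val [` iU]%fset) override_in ffunE /= decodeK.
    rewrite override_out // /z /= decodeK su //.
    by move: iU; rewrite in_heap_prefix decodeK; rewrite /N in iN; lia.
  split; first exact: prefix_cyl_ext.
  rewrite (@loc_weight_prefix _ _ _ _ _ s) //.
    by apply: cut_weight_ext => // i iM; apply: eq; rewrite /N; nia.
  by move=> i iM; rewrite su // eq // /N; lia.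
have [e [-> ->]] := key s (fun _ _ => erefl); have [e' [-> ->]] := key t st.
have ok : bdry_ok adj U z.
  move=> x y; rewrite !in_bdry_prefix // => /andP[x1 x2] /andP[y1 y2].
  case/tree_adjP=> -[p0 e1]; exfalso.
    by move: y2; rewrite e1 in x1; rewrite /heap_parent leq_divRL // in x1; move: p0 x1; lia.
  by move: x2; rewrite e1 in y1; rewrite /heap_parent leq_divRL // in y1; move: p0 y1; lia.
rewrite !(gibbs_spec _ _ tch) !local_spec_ok //; try exact/bdry_ok_override;
  try exact: tree_adj_sym; try exact: in_bdry_tree.
have Z (e0 : {ffun U -> 'I_3}) : \sum_(eta : {ffun U -> 'I_3})
    loc_weight adj lam U (override eta (override e0 z)) =
    \sum_(eta : {ffun U -> 'I_3}) loc_weight adj lam U (override eta z).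
  by apply: eq_bigr => eta _; rewrite override_override.
by rewrite !Z; ring.
Qed.

End GibbsDLR.

Section CutStep.
Variables (n : nat) (R : realType) (lam : R) (p : R * R) (C : R).
Hypotheses (C0 : 0 < C)
  (fixC : forall m j, (j <= 2)%N -> msg_rec n lam (fun=> ratio p) m j = C * ratio p j).

Let q m s := C^-1 ^+ m * cut_weight n lam (fun=> ratio p) m s.

Lemma stationary_cut0 s : q 0 s = 1.
Proof.
rewrite /q expr0 mul1r /cut_weight /heap_weight big_geq // mul1r muln0 big_nat1.
by [].
Qed.

(** Consistency of the masses: summing out vertex m multiplies the weight by C,
    since a stationary message reproduces itself up to C. *)
Lemma stationary_cut_sum m s : q m s = \sum_(a : 'I_3) q m.+1 (upd s m a).
Proof.
pose r' v j := (if v == m then C else 1) * ratio p j.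
rewrite /q -mulr_sumr (@cut_weight_elim R n lam (fun=> ratio p) r').
- have -> : cut_weight n lam r' m s = C * cut_weight n lam (fun=> ratio p) m s.
    have mb : (m < (n.+1 * m).+1)%N by nia.
    rewrite /cut_weight !(big_ltn mb) /r' eqxx -/r'.
    have -> : \prod_(m.+1 <= v < (n.+1 * m).+1) r' v (parent_spin n s v) =
        \prod_(m.+1 <= v < (n.+1 * m).+1) ratio p (parent_spin n s v).
      by apply: eq_big_nat => v /andP[mv _]; rewrite /r' gtn_eqF // mul1r.
    by ring.
  by rewrite exprSr -[RHS]mulrA (mulrA C^-1) mulVf ?mul1r // gt_eqF.
- by move=> v mv; apply/funext => j; rewrite /r' gtn_eqF // mul1r.
- by move=> j j2; rewrite /r' eqxx fixC.
Qed.

End CutStep.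

Theorem corollary3p2 (R : realType) (b : nat) (hb : (2 <= b)%N)
    (lam : R) (hlam : 0 < lam)
    (hle : lam <= b%:R ^+ b / (b.-1)%:R ^+ b.+1) :
  @has_unique_gibbs (seq 'I_b) 2 (@tree_adj b) R lam.
Proof.
case: b hb hle => [//|n] n0 hle; rewrite ltnS in n0.
have hl : lam * (n%:R / n.+1%:R) ^+ n.+1 * n%:R <= 1.
  have N0 : 0 < n%:R :> R by rewrite ltr0n.
  have S0 : 0 < n.+1%:R :> R by rewrite ltr0n.
  move: hle; rewrite /= ler_pdivlMr ?exprn_gt0 // exprSr mulrA => h.
  by rewrite expr_div_n mulrA mulrAC ler_pdivrMr ?exprn_gt0 // mul1r.
have [p [p1 p2 pfix plim]] := msg_limit hlam n0 hl.
have [C C0 fixC] := parent_fix_const hlam p1 p2 pfix.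
pose q m s := C^-1 ^+ m * cut_weight n lam (fun=> ratio p) m s.
have q0 s : q 0%N s = 1 by exact: stationary_cut0.
have q_sum m s : q m s = \sum_(a : 'I_3) q m.+1 (upd s m a) by exact: stationary_cut_sum.
have q_ge0 m s : 0 <= q m s.
  have Ci : 0 <= C^-1 by rewrite invr_ge0 ltW.
  rewrite mulr_ge0 ?exprn_ge0 //.
  rewrite mulr_ge0 ?heap_weight_ge0 // prodr_ge0 // => v _.
  by case: (parent_spin _ _ _) => [|[|j]] //=; rewrite ?mulr_ge0 ?ltW.
have q_ext m s t : (forall i, (i < m)%N -> s i = t i) -> q m s = q m t.
  by move=> st; rewrite /q; congr (_ * _); apply: cut_weight_ext.
have [mu muE] := @kolmogorov_extension n R q q0 q_ge0 q_sum q_ext.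
exists mu; split; first exact: (cut_measure_gibbs hlam (c := fun m => C^-1 ^+ m) muE).
move=> nu nuG; apply: probability_prefix_ext => m s.
pose N m s := fine (nu (@prefix_cyl n setT m s)).
have fin m' s' : nu (@prefix_cyl n setT m' s') = (N m' s')%:E.
  by rewrite fineK // fin_num_measure //; exact: measurable_prefix_cyl.
have Nge0 m' s' : 0 <= N m' s' by rewrite fine_ge0.
have Nsum m' s' : N m' s' = \sum_(a : 'I_3) N m'.+1 (upd s' m' a).
  rewrite /N prefix_mass_split; under eq_bigr do rewrite fin.
  by rewrite sumEFin.
have Next m' s' t : (forall i, (i < m')%N -> s' i = t i) -> N m' s' = N m' t.
  by move=> st; rewrite /N; congr (fine (nu _)); exact: prefix_cyl_ext.
have Ndlr := gibbs_cut hlam nuG.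
have ratioE t : N m s * q m t = N m t * q m s.
  have := marginal_ratio hlam p1 p2 plim Nge0 Nsum Next Ndlr m s t.
  set x := cut_weight _ _ _ m s; set y := cut_weight _ _ _ m t => E.
  by rewrite /q -/x -/y mulrCA E mulrCA.
rewrite muE fin; congr EFin.
have total (F : nat -> (nat -> 'I_3) -> R) :
    (forall m' s', F m' s' = \sum_(a : 'I_3) F m'.+1 (upd s' m' a)) -> F 0%N s = 1 ->
    sumc m 0 (F m) s = 1.
  by move=> Fsum F0; rewrite -F0 (N_sumc Fsum m 0).
have N0 : N 0%N s = 1 by rewrite /N prefix_cyl0 probability_setT.
rewrite -[LHS]mulr1 -(total q q_sum (q0 s)) -sumcZ.
rewrite -[RHS]mulr1 -(total N Nsum N0) -sumcZ.
by apply: eq_sumc => t _ _; rewrite ratioE mulrC.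
Qed.
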